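(* Let $M$ be a universal semi-POVM. Then there exist constants $c\ge 0$ and $c'>0$ such that for every density matrix $\rho\in\mathrm{Her}(N)$ and every $s\in\Sigma^*$: $$\bigl|K(s)+\log_2\operatorname{tr}(\rho M(s))\bigr|\le c,$$ and $$c'\,P(s)\le\operatorname{tr}(\rho M(s)),\qquad c'\,\operatorname{tr}(\rho M(s))\le P(s).$$
   Context: $N$ is a fixed positive integer; $\Sigma^*$ is the set of finite binary strings. $\mathrm{Her}(N)$ is the set of $N\times N$ Hermitian matrices and $\mathrm{Her}_Q(N)$ those with entries in $\{a+ib:a,b\in\mathbb{Q}\}$; $A\leqslant B$ means $B-A$ is positive semi-definite. A density matrix is $\rho\in\mathrm{Her}(N)$, $0\leqslant\rho$, $\operatorname{tr}\rho=1$. A semi-POVM on $\Sigma^*$ is a map $R:\Sigma^*\to\mathrm{Her}(N)$ with $0\leqslant R(s)$ for all $s$ and $\sum_s R(s)\leqslant I$. A lower-computable semi-POVM is a semi-POVM $R$ for which there is a total recursive $f:\mathbb{N}\times\Sigma^*\to\mathrm{Her}_Q(N)$ with $\lim_{n}f(n,s)=R(s)$ and $f(n,s)\leqslant R(s)$ for all $n,s$. A universal semi-POVM is a lower-computable semi-POVM $M$ such that for every lower-computable semi-POVM $R$ there is $c>0$ with $c\,R(s)\leqslant M(s)$ for all $s\in\Sigma^*$. A computer is a partial recursive function $C:\Sigma^*\to\Sigma^*$ with prefix-free domain; a computer $U$ is optimal if for every computer $C$ there is a constant $\mathrm{sim}(C)$ such that whenever $C(p)$ is defined there is $p'$ with $U(p')=C(p)$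 and $|p'|\le|p|+\mathrm{sim}(C)$. Fix an optimal computer $U$; $K(s)=\min\{|p|:U(p)=s\}$ and $P(s)=\sum_{U(p)=s}2^{-|p|}$. *)

(* Defs.v *)
(* Complex numbers: mathcomp-real-closed's R[i]. *)
From HB Require Import structures.
From mathcomp Require Import all_boot all_order all_algebra.
From mathcomp Require Import complex spectral.
From mathcomp Require Import all_classical all_reals all_analysis.

Set Implicit Arguments.
Unset Strict Implicit.
Unset Printing Implicit Defensive.

Import Order.TTheory GRing.Theory Num.Theory.
Import numFieldNormedType.Exports.
Local Open Scope ring_scope.

(* 1. Partial recursive functions (mu-recursive functions on nat).     *)

(* Codes of mu-recursive functions; arguments are passed as a list.   *)
Inductive recf : Type :=
| RZero                            (* constant 0                      *)
| RSucc                            (* successor of the first argument *)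
| RProj (i : nat)                  (* i-th argument (0-based)         *)
| RComp (f : recf) (gs : seq recf) (* f (g_1 xs, ..., g_k xs)         *)
| RPrec (f g : recf)               (* primitive recursion, 1st arg    *)
| RMin (f : recf).                 (* mu-operator on the 1st argument *)

(* Big-step semantics: [eval e xs y] means e halts on xs with output y. *)
Inductive eval : recf -> seq nat -> nat -> Prop :=
| eZero xs : eval RZero xs 0
| eSucc x xs : eval RSucc (x :: xs) x.+1
| eProj i xs : (i < size xs)%N -> eval (RProj i) xs (nth 0%N xs i)
| eComp f gs xs ys y : evals gs xs ys -> eval f ys y -> eval (RComp f gs) xs y
| ePrec0 f g xs y : eval f xs y -> eval (RPrec f g) (0%N :: xs) y
| ePrecS f g n xs r y :
    eval (RPrec f g) (n :: xs) r -> eval g (n :: r :: xs) y ->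
    eval (RPrec f g) (n.+1 :: xs) y
| eMin f xs n :
    eval f (n :: xs) 0 ->
    (forall m, (m < n)%N -> exists k, eval f (m :: xs) k.+1) ->
    eval (RMin f) xs n
with evals : seq recf -> seq nat -> seq nat -> Prop :=
| esNil xs : evals [::] xs [::]
| esCons g gs xs y ys : eval g xs y -> evals gs xs ys -> evals (g :: gs) xs (y :: ys).

(* Finite binary strings Sigma^* = seq bool, coded in nat by [pickle]. *)
Definition bstring := seq bool.

(* A partial function Sigma^* -> Sigma^* is partial recursive. *)
Definition partial_recursive (C : bstring -> option bstring) : Prop :=
  exists e : recf, forall (s : bstring) (y : nat),
    eval e [:: pickle s] y <-> exists t, C s = Some t /\ y = pickle t.

(* A computer: partial recursive with prefix-free domain. *)
Definition prefix_free_dom (C : bstring -> option bstring) : Prop :=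
  forall p q : bstring, C p <> None -> C q <> None -> prefix p q -> p = q.

Definition computer (C : bstring -> option bstring) : Prop :=
  partial_recursive C /\ prefix_free_dom C.

(* Optimal computer. *)
Definition optimal (U : bstring -> option bstring) : Prop :=
  computer U /\
  forall C, computer C -> exists sim : nat,
    forall p t, C p = Some t ->
      exists p', U p' = Some t /\ (size p' <= size p + sim)%N.

(* Prefix complexity K(s) = min { |p| : U p = s } (0 if no program). *)
Definition has_prog_of_size (U : bstring -> option bstring) (s : bstring) : pred nat :=
  fun n => `[< exists p : bstring, size p = n /\ U p = Some s >].

Definition Kc (U : bstring -> option bstring) (s : bstring) : nat :=
  match pselect (exists n, has_prog_of_size U s n) with
  | left H => ex_minn H
  | right _ => 0%N
  end.

(* Algorithmic probability P(s) = sum_{U p = s} 2^{-|p|}. *)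
Definition Pu (R : realType) (U : bstring -> option bstring) (s : bstring) : R :=
  fine (\esum_(p in [set p : bstring | U p = Some s]) ((2 : R) ^- size p)%:E)%E.

(* 2. Hermitian matrices over C = R[i] and the Loewner order.          *)

Local Open Scope sesquilinear_scope.

Definition hermitian (R : realType) (N : nat) (A : 'M[R[i]]_N) : Prop :=
  A ^t* = A.

Definition psd (R : realType) (N : nat) (A : 'M[R[i]]_N) : Prop :=
  hermitian A /\ forall v : 'rV[R[i]]_N, 0 <= (v *m A *m v ^t*) 0 0.

(* A <= B  iff  B - A is positive semi-definite *)
Definition loewner (R : realType) (N : nat) (A B : 'M[R[i]]_N) : Prop :=
  psd (B - A).

Definition density (R : realType) (N : nat) (rho : 'M[R[i]]_N) : Prop :=
  hermitian rho /\ psd rho /\ \tr rho = 1.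

(* Her_Q(N): a matrix with Gaussian rational entries, coded by the pair
   (real part, imaginary part) of rational matrices. *)
Definition gaussQ (N : nat) := ('M[rat]_N * 'M[rat]_N)%type.

Definition toC (R : realType) (N : nat) (A : gaussQ N) : 'M[R[i]]_N :=
  \matrix_(i, j) (Complex (ratr (A.1 i j)) (ratr (A.2 i j)) : R[i]).

(* Total recursive f : N x Sigma^* -> Her_Q(N). *)
Definition total_recursive2 (N : nat) (f : nat -> bstring -> gaussQ N) : Prop :=
  exists e : recf, forall n s, eval e [:: n; pickle s] (pickle (f n s)).

(* Semi-POVM: R(s) >= 0 and sum_s R(s) <= I (sum of PSD terms, i.e. all
   finite partial sums are <= I). *)
Definition semiPOVM (R : realType) (N : nat) (Rm : bstring -> 'M[R[i]]_N) : Prop :=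
  (forall s, loewner 0 (Rm s)) /\
  (forall S : seq bstring, uniq S -> loewner (\sum_(s <- S) Rm s) 1%:M).

(* entrywise convergence of a sequence of complex matrices *)
Definition mx_cvg (R : realType) (N : nat) (u : nat -> 'M[R[i]]_N) (l : 'M[R[i]]_N) : Prop :=
  forall i j,
    ((fun n => complex.Re (u n i j)) @ \oo --> complex.Re (l i j))%classic /\
    ((fun n => complex.Im (u n i j)) @ \oo --> complex.Im (l i j))%classic.

Definition lower_computable (R : realType) (N : nat) (Rm : bstring -> 'M[R[i]]_N) : Prop :=
  semiPOVM Rm /\
  exists f : nat -> bstring -> gaussQ N,
    total_recursive2 f /\
    (forall n s, hermitian (toC R (f n s))) /\
    (forall s, mx_cvg (fun n => toC R (f n s)) (Rm s)) /\
    (forall n s, loewner (toC R (f n s)) (Rm s)).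

Definition universal (R : realType) (N : nat) (M : bstring -> 'M[R[i]]_N) : Prop :=
  lower_computable M /\
  forall Rm : bstring -> 'M[R[i]]_N, lower_computable Rm ->
    exists c : R, 0 < c /\ forall s, loewner ((c%:C)%C *: Rm s) (M s).

Definition log2 (R : realType) (x : R) : R := ln x / ln 2.

(* Main.v *)
Require Import Defs.
From HB Require Import structures.
From mathcomp Require Import all_boot all_order all_algebra.
From mathcomp Require Import complex spectral zify ring lra.
From mathcomp Require Import all_classical all_reals all_analysis.

Set Implicit Arguments.
Unset Strict Implicit.
Unset Printing Implicit Defensive.

Import Order.TTheory GRing.Theory Num.Theory.
Import numFieldNormedType.Exports.

(** Three comparisons, each up to a multiplicative constant, close the circle
    [P(s) <~ tr(rho M(s)) <~ 2^-K(s) <= P(s)].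

    - [P(s) I] is a lower-computable semi-POVM: [P] is a semimeasure by Kraft's
      inequality, and [P(s)] is the limit from below of the dyadic sums over the
      programs found within [n] steps.  Universality of [M] gives
      [a P(s) I <= M(s)], hence [a P(s) <= tr(rho M(s))].

    - [tr(rho M(s)) <= tr M(s)], and every diagonal entry of [M] is a
      lower-semicomputable semimeasure [m].  Request a program of length about
      [k] for [s] as soon as [2^-k < m(s)] is observed; for fixed [s] the
      requests have total weight at most [m(s)], so they can be allotted
      consecutive intervals of the unit interval, and a dyadic interval chosen
      inside each yields a prefix-free machine.  By optimality [U] has programs
      of essentially the same length, i.e. [m(s) <~ 2^-K(s)].

    - A shortest program of [s] contributes [2^-K(s)] to [P(s)]. *)

(* [all_analysis] has its own [eval]. *)
Local Notation eval := Defs.eval.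

(** * Computable functions *)

(* An input [x : X] is passed to a code as the list [encode x].  Its length is
   fixed, for the arguments of a code are selected by their positions. *)
Record encoding (X : Type) := Encoding {
  arity : nat;
  encode :> X -> seq nat;
  size_encode : forall x, size (encode x) = arity }.

Definition enc1 {T : countType} : encoding T :=
  @Encoding T 1 (fun x => [:: pickle x]) (fun=> erefl).

Definition enc_cons (T : countType) X (enc : encoding X) : encoding (T * X) :=
  Encoding (fun y => congr1 succn (size_encode enc y.2)
              : size (pickle y.1 :: enc y.2) = (arity enc).+1).
Arguments enc_cons {T X} enc.

Definition computable X (enc : encoding X) (T : countType) (F : X -> T) :=
  exists e, forall x, eval e (enc x) (pickle (F x)).

Definition computable_vec X (enc : encoding X) (V : X -> seq nat) :=
  exists es, forall x, evals es (enc x) (V x).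

Create HintDb comp.

Ltac comp := auto 200 with comp nocore.

Section Closure.

Variables (X : Type) (enc : encoding X).

Lemma computable_ext (T : countType) (F G : X -> T) :
  F =1 G -> computable enc F -> computable enc G.
Proof. by move=> FG [e eP]; exists e => x; rewrite -FG; exact: eP. Qed.

Lemma computable_of_pickle (T : countType) (F : X -> nat) (G : X -> T) :
  (forall x, pickle (G x) = F x) -> computable enc F -> computable enc G.
Proof. by move=> GF [e eP]; exists e => x; rewrite GF; exact: eP. Qed.

Lemma computable_comp Y (enc' : encoding Y) (T : countType) (F : Y -> T) h :
  computable enc' F -> computable_vec enc (fun x => enc' (h x)) ->
  computable enc (fun x => F (h x)).
Proof.
move=> [e eP] [es esP]; exists (RComp e es) => x.
exact: eComp (esP x) (eP _).
Qed.

Lemma computable_vec_nil : computable_vec enc (fun=> [::]).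
Proof. by exists [::] => x; exact: esNil. Qed.

Lemma computable_vec_cons (G : X -> nat) V :
  computable enc G -> computable_vec enc V ->
  computable_vec enc (fun x => G x :: V x).
Proof. by move=> [e eP] [es esP]; exists (e :: es) => x; exact: esCons. Qed.

Lemma computable_vec_nth (V : X -> seq nat) k :
  (forall x, size (V x) = k) ->
  (forall i, i < k -> computable enc (fun x => nth 0 (V x) i)) ->
  computable_vec enc V.
Proof.
elim: k V => [|k IH] V szV cV.
  by exists [::] => x; rewrite (size0nil (szV x)); exact: esNil.
have [es esP] : computable_vec enc (fun x => behead (V x)).
  apply: IH => [x|i ik]; first by rewrite size_behead szV.
  by apply: computable_ext (cV i.+1 ik) => x; rewrite nth_behead.
have [e eP] := cV 0 isT; exists (e :: es) => x.
have := szV x; have := esP x; have := eP x.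
by case: (V x) => //= *; exact: esCons.
Qed.

Lemma computable_nth_encode i :
  i < arity enc -> computable enc (fun x => nth 0 (enc x) i).
Proof.
by move=> ik; exists (RProj i) => x; apply: eProj; rewrite size_encode.
Qed.

Lemma computable_vec_encode : computable_vec enc enc.
Proof.
exact: computable_vec_nth (size_encode enc) computable_nth_encode.
Qed.

Lemma computable_succ (G : X -> nat) :
  computable enc G -> computable enc (fun x => (G x).+1).
Proof.
move=> cG; apply: (computable_comp (enc' := enc1) (F := succn)).
  by exists RSucc => x; exact: eSucc.
by apply: computable_vec_cons cG _; exact: computable_vec_nil.
Qed.

Lemma computable_const (T : countType) (c : T) : computable enc (fun=> c).
Proof.
apply: (computable_of_pickle (F := fun=> pickle c)) => //.
elim: (pickle c) => [|n IH]; last exact: computable_succ.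
by exists RZero => x; exact: eZero.
Qed.

End Closure.

Lemma computable_id (T : countType) : computable enc1 (fun x : T => x).
Proof. by exists (RProj 0) => x; exact: (@eProj 0 [:: pickle x]). Qed.

Lemma computable_head (T : countType) X (enc : encoding X) :
  computable (enc_cons enc) (fun y : T * X => y.1).
Proof. exact: (@computable_nth_encode _ (enc_cons enc) 0). Qed.

Lemma computable_vec_snd (T : countType) X (enc : encoding X) :
  computable_vec (enc_cons enc) (fun y : T * X => enc y.2).
Proof.
apply: (computable_vec_nth (k := arity enc)) => [y|i ik].
  exact: size_encode.
exact: (@computable_nth_encode _ (enc_cons enc) i.+1).
Qed.

Lemma evals_comp ps es xs ys zs :
  evals ps xs ys -> evals es ys zs -> evals [seq RComp e ps | e <- es] xs zs.
Proof.
move=> psP; elim: es zs => [|e es IH] zs esP.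
  by inversion esP; subst; exact: esNil.
inversion esP; subst; apply: esCons; last exact: IH.
exact: eComp psP _.
Qed.

Lemma computable_vec_weaken (T : countType) X (enc : encoding X) V :
  computable_vec enc V ->
  computable_vec (enc_cons enc) (fun y : T * X => V y.2).
Proof.
move=> [es esP]; have [ps psP] := computable_vec_snd T enc.
by exists [seq RComp e ps | e <- es] => y; exact: evals_comp (psP y) (esP _).
Qed.

Lemma computable_weaken (S T : countType) X (enc : encoding X) (G : X -> T) :
  computable enc G -> computable (enc_cons enc) (fun y : S * X => G y.2).
Proof. by move=> cG; apply: computable_comp cG (computable_vec_snd S enc). Qed.

(* Fails if [F] uses the first component of its argument. *)
Ltac weaken F tac :=
  let G := eval cbn [fst snd] in (fun n x => F (n, x)) in
  lazymatch G with (fun _ => ?G') => tac G' end.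

#[global] Hint Extern 1 (computable (enc_cons _) ?F) =>
  weaken F ltac:(fun G =>
    simple apply (@computable_weaken _ _ _ _ G)) : comp.
#[global] Hint Extern 1 (computable_vec (enc_cons _) ?V) =>
  weaken V ltac:(fun V' =>
    simple apply (@computable_vec_weaken _ _ _ V')) : comp.
#[global] Hint Resolve computable_id computable_head computable_const
  computable_succ computable_vec_nil computable_vec_cons
  computable_vec_encode : comp.

Lemma computable_pickle X (enc : encoding X) (T : countType) (F : X -> T) :
  computable enc F -> computable enc (fun x => pickle (F x)).
Proof. by []. Qed.
#[global] Hint Resolve computable_pickle : comp.

Lemma computable_apply1 X (enc : encoding X) (S T : countType) (f : S -> T) G :
  computable enc1 f -> computable enc G -> computable enc (fun x => f (G x)).
Proof. by move=> cf cG; apply: computable_comp cf _ => /=; comp. Qed.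
#[global] Hint Extern 3 (computable _ _) =>
  match goal with
  | cf : computable enc1 ?f |- computable _ (fun x => ?f (@?G x)) =>
    simple apply (computable_apply1 (G := G) cf)
  end : comp.

Lemma computable_weaken_snd (S S' T : countType) X (enc : encoding X)
    (f : S -> X -> T) :
  computable (enc_cons enc) (fun y => f y.1 y.2) ->
  computable (enc_cons (enc_cons enc)) (fun y : S * (S' * X) => f y.1 y.2.2).
Proof.
move=> cf; apply: (computable_comp (h := fun y => (y.1, y.2.2)) cf) => /=.
by comp.
Qed.

Lemma computable_iteri X (enc : encoding X) (T : countType) (n : X -> nat)
    (B : X -> T) (S : nat -> T -> X -> T) :
  computable enc n -> computable enc B ->
  computable (enc_cons (enc_cons enc)) (fun y => S y.1 y.2.1 y.2.2) ->
  computable enc (fun x => iteri (n x) (fun m r => S m r x) (B x)).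
Proof.
move=> cn [b bP] [s sP].
apply: (computable_comp (enc' := enc_cons enc) (h := fun x => (n x, x))
  (F := fun y => iteri y.1 (fun m r => S m r y.2) (B y.2))).
  exists (RPrec b s) => -[m x] /=; elim: m => [|m IH] /=; first exact: ePrec0.
  by apply: ePrecS IH _; exact: (sP (m, (_, x))).
by rewrite /=; comp.
Qed.
#[global] Hint Resolve computable_iteri : comp.

(** * Arithmetic *)

Lemma computable_pred X (enc : encoding X) (G : X -> nat) :
  computable enc G -> computable enc (fun x => (G x).-1).
Proof.
move=> cG; apply: (computable_ext (F := fun x => iteri (G x) (fun m _ => m) 0)).
  by move=> x; case: (G x).
by comp.
Qed.
#[global] Hint Resolve computable_pred : comp.

Lemma computable_add X (enc : encoding X) (G H : X -> nat) :
  computable enc G -> computable enc H -> computable enc (fun x => G x + H x).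
Proof.
move=> cG cH.
apply: (computable_ext (F := fun x => iteri (G x) (fun _ r => r.+1) (H x))).
  by move=> x; elim: (G x) => //= m ->.
by comp.
Qed.
#[global] Hint Resolve computable_add : comp.

Lemma computable_mul X (enc : encoding X) (G H : X -> nat) :
  computable enc G -> computable enc H -> computable enc (fun x => G x * H x).
Proof.
move=> cG cH.
apply: (computable_ext (F := fun x => iteri (G x) (fun _ r => H x + r) 0)).
  by move=> x; elim: (G x) => //= m ->; rewrite mulSn.
by comp.
Qed.
#[global] Hint Resolve computable_mul : comp.

Lemma computable_sub X (enc : encoding X) (G H : X -> nat) :
  computable enc G -> computable enc H -> computable enc (fun x => G x - H x).
Proof.
move=> cG cH.
apply: (computable_ext (F := fun x => iteri (H x) (fun _ r => r.-1) (G x))).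
  by move=> x; elim: (H x) => [|m /= ->]; rewrite ?subn0 // subnS.
by comp.
Qed.
#[global] Hint Resolve computable_sub : comp.

Lemma computable_exp X (enc : encoding X) (G H : X -> nat) :
  computable enc G -> computable enc H -> computable enc (fun x => G x ^ H x).
Proof.
move=> cG cH.
apply: (computable_ext (F := fun x => iteri (H x) (fun _ r => G x * r) 1)).
  by move=> x; elim: (H x) => //= m ->; rewrite expnS.
by comp.
Qed.
#[global] Hint Resolve computable_exp : comp.

Lemma computable_nat_of_bool X (enc : encoding X) (b : X -> bool) :
  computable enc b -> computable enc (fun x => nat_of_bool (b x)).
Proof. by []. Qed.
#[global] Hint Resolve computable_nat_of_bool : comp.

Lemma computable_leq X (enc : encoding X) (G H : X -> nat) :
  computable enc G -> computable enc H -> computable enc (fun x => G x <= H x).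
Proof.
move=> cG cH; apply: (computable_of_pickle (F := fun x => 1 - (G x - H x))).
  by move=> x; rewrite /leq; case: (_ - _).
by comp.
Qed.
#[global] Hint Resolve computable_leq : comp.

Lemma computable_andb X (enc : encoding X) (b c : X -> bool) :
  computable enc b -> computable enc c -> computable enc (fun x => b x && c x).
Proof.
move=> cb cc; apply: (computable_of_pickle (F := fun x => b x * c x)).
  by move=> x; rewrite mulnb.
by comp.
Qed.
#[global] Hint Resolve computable_andb : comp.

Lemma computable_negb X (enc : encoding X) (b : X -> bool) :
  computable enc b -> computable enc (fun x => ~~ b x).
Proof.
move=> cb; apply: (computable_of_pickle (F := fun x => 1 - b x)).
  by move=> x; case: (b x).
by comp.
Qed.
#[global] Hint Resolve computable_negb : comp.

Lemma computable_eq X (enc : encoding X) (T : countType) (F G : X -> T) :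
  computable enc F -> computable enc G -> computable enc (fun x => F x == G x).
Proof.
move=> cF cG; apply: (computable_ext (F := fun x =>
  (pickle (F x) <= pickle (G x)) && (pickle (G x) <= pickle (F x)))).
  by move=> x; rewrite -eqn_leq (inj_eq (pcan_inj pickleK)).
by comp.
Qed.
(* Unlike [apply:], [auto] does not infer canonical structures. *)
#[global] Hint Extern 2 (computable _ (fun _ => _ == _)) =>
  apply: computable_eq : comp.

Lemma computable_if X (enc : encoding X) (T : countType) (b : X -> bool)
    (F G : X -> T) :
  computable enc b -> computable enc F -> computable enc G ->
  computable enc (fun x => if b x then F x else G x).
Proof.
move=> cb cF cG; apply: (computable_of_pickle (F := fun x =>
  b x * pickle (F x) + (1 - b x) * pickle (G x))); last by comp.
by move=> x; case: (b x); rewrite ?mul1n ?mul0n ?addn0.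
Qed.
#[global] Hint Resolve computable_if : comp.

Lemma computable_sum X (enc : encoding X) (n : X -> nat) (f : nat -> X -> nat) :
  computable enc n -> computable (enc_cons enc) (fun y => f y.1 y.2) ->
  computable enc (fun x => \sum_(0 <= i < n x) f i x).
Proof.
move=> cn cf; apply: (computable_ext (F := fun x =>
  iteri (n x) (fun m r => r + f m x) 0)).
  move=> x; elim: (n x) => [|m /= ->]; first by rewrite big_nil.
  by rewrite big_nat_recr.
by have := computable_weaken_snd nat cf; comp.
Qed.
#[global] Hint Resolve computable_sum : comp.

Lemma computable_bigmax X (enc : encoding X) (n : X -> nat)
    (b : nat -> X -> bool) :
  computable enc n -> computable (enc_cons enc) (fun y => b y.1 y.2) ->
  computable enc (fun x => \max_(0 <= i < n x | b i x) i).
Proof.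
move=> cn cb; apply: (computable_ext (F := fun x =>
  iteri (n x) (fun m r => if b m x then m else r) 0)).
  move=> x; elim: (n x) => [|m /= ->]; first by rewrite big_nil.
  rewrite [RHS]big_mkcond big_nat_recr //= -big_mkcond /=.
  case: (b m x); last by rewrite maxn0.
  apply/esym/maxn_idPr; rewrite big_nat_cond.
  by apply/bigmax_leqP_seq => i _ /andP[/ltnW].
by have := computable_weaken_snd nat cb; comp.
Qed.
#[global] Hint Resolve computable_bigmax : comp.

Lemma computable_find X (enc : encoding X) (n : X -> nat)
    (b : nat -> X -> bool) :
  computable enc n -> computable (enc_cons enc) (fun y => b y.1 y.2) ->
  computable enc (fun x => find (fun i => b i x) (iota 0 (n x))).
Proof.
move=> cn cb; apply: (computable_ext (F := fun x =>
  iteri (n x) (fun m r => r + ((r == m) && ~~ b m x)) 0)).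
  move=> x; elim: (n x) => [//|m]; rewrite iteriS => ->.
  rewrite -[in RHS]addn1 iotaD find_cat size_iota /= add0n; set s := iota 0 m.
  case: (boolP (has _ s)) => [h|/hasNfind].
    by rewrite ltn_eqF ?addn0 // -[ltnRHS](size_iota 0 m) -has_find.
  by rewrite size_iota => ->; rewrite eqxx; case: (b m x).
by have := computable_weaken_snd nat cb; comp.
Qed.
#[global] Hint Resolve computable_find : comp.

Lemma computable_all X (enc : encoding X) (n : X -> nat)
    (b : nat -> X -> bool) :
  computable enc n -> computable (enc_cons enc) (fun y => b y.1 y.2) ->
  computable enc (fun x => all (fun i => b i x) (iota 0 (n x))).
Proof.
move=> cn cb; apply: (computable_ext (F := fun x =>
  n x <= find (fun i => ~~ b i x) (iota 0 (n x)))); last by comp.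
move=> x; rewrite -[LHS]negbK -ltnNge -[X in _ < X](size_iota 0) -has_find.
by rewrite has_predC negbK.
Qed.
#[global] Hint Resolve computable_all : comp.

Lemma bigmax_le_threshold n m : m <= n -> \max_(0 <= i < n.+1 | i <= m) i = m.
Proof.
move=> mn; apply/eqP; rewrite eqn_leq; apply/andP; split.
  by apply/bigmax_leqP_seq.
apply: (@leq_bigmax_seq _ _ (fun i => i <= m) id) => //.
by rewrite mem_index_iota.
Qed.

Lemma computable_div X (enc : encoding X) (G H : X -> nat) :
  computable enc G -> computable enc H -> computable enc (fun x => G x %/ H x).
Proof.
move=> cG cH; apply: (computable_ext (F := fun x =>
  if 0 < H x then \max_(0 <= q < (G x).+1 | q * H x <= G x) q else 0)).
  move=> x; case: (H x) => [|d] /=; first by rewrite divn0.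
  rewrite -(bigmax_le_threshold (leq_div (G x) d.+1)).
  by apply: eq_bigl => q; rewrite leq_divRL.
by comp.
Qed.
#[global] Hint Resolve computable_div : comp.

Lemma computable_mod X (enc : encoding X) (G H : X -> nat) :
  computable enc G -> computable enc H -> computable enc (fun x => G x %% H x).
Proof.
move=> cG cH; apply: (computable_ext (F := fun x => G x - G x %/ H x * H x)).
  by move=> x; rewrite {1}(divn_eq (G x) (H x)) addKn.
by comp.
Qed.
#[global] Hint Resolve computable_mod : comp.

Lemma computable_odd X (enc : encoding X) (G : X -> nat) :
  computable enc G -> computable enc (fun x => odd (G x)).
Proof.
move=> cG; apply: (computable_of_pickle (F := fun x => G x %% 2)); last by comp.
by move=> x; rewrite modn2.
Qed.
#[global] Hint Resolve computable_odd : comp.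

Lemma computable_dvd X (enc : encoding X) (G H : X -> nat) :
  computable enc G -> computable enc H -> computable enc (fun x => G x %| H x).
Proof. by move=> cG cH; rewrite /dvdn; comp. Qed.
#[global] Hint Resolve computable_dvd : comp.

Lemma computable_logn X (enc : encoding X) p (G : X -> nat) :
  computable enc G -> computable enc (fun x => logn p (G x)).
Proof.
move=> cG; have [pp|pN] := boolP (prime p); last first.
  apply: computable_ext (computable_const enc 0) => x.
  by rewrite lognE (negbTE pN).
apply: (computable_ext (F := fun x =>
  if G x == 0 then 0 else \max_(0 <= i < (G x).+1 | p ^ i %| G x) i)).
  move=> x; case: eqP => [->|/eqP]; first by rewrite logn0.
  rewrite -lt0n => G0; rewrite -(bigmax_le_threshold (ltnW (ltn_logl p G0))).
  by apply: eq_bigl => i; rewrite pfactor_dvdn.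
by comp.
Qed.
#[global] Hint Resolve computable_logn : comp.

Lemma computable_gcd X (enc : encoding X) (G H : X -> nat) :
  computable enc G -> computable enc H ->
  computable enc (fun x => gcdn (G x) (H x)).
Proof.
move=> cG cH; apply: (computable_ext (F := fun x =>
  \max_(0 <= d < (G x + H x).+1 | (d %| G x) && (d %| H x)) d)); last by comp.
move=> x; set a := G x; set b := H x.
have [/eqP|ab0] := posnP (a + b).
  by rewrite addn_eq0 => /andP[/eqP-> /eqP->]; rewrite big_mkcond big_nat1.
have g0 : 0 < gcdn a b by rewrite gcdn_gt0 -addn_gt0.
have g_le : gcdn a b <= a + b.
  by apply: dvdn_leq => //; rewrite dvdn_add ?dvdn_gcdl ?dvdn_gcdr.
apply/eqP; rewrite eqn_leq; apply/andP; split.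
  apply/bigmax_leqP_seq => d _; rewrite -dvdn_gcd; exact: dvdn_leq.
apply: (@leq_bigmax_seq _ _ (fun d => (d %| a) && (d %| b)) id).
  by rewrite mem_index_iota.
by rewrite dvdn_gcdl dvdn_gcdr.
Qed.
#[global] Hint Resolve computable_gcd : comp.

(** * Codes of sequences *)

(* [CodeSeq.code (n :: s)] is [2 ^ n * (2 * CodeSeq.code s + 1)]. *)
Definition code_tail (t : nat) : nat := t %/ 2 ^ logn 2 t %/ 2.

Lemma logn_code n s : logn 2 (CodeSeq.code (n :: s)) = n.
Proof.
by rewrite /= lognM ?expn_gt0 // pfactorK // lognE dvdn2 /= odd_double addn0.
Qed.

Lemma code_tail_code n s : code_tail (CodeSeq.code (n :: s)) = CodeSeq.code s.
Proof.
rewrite /code_tail logn_code /= mulKn ?expn_gt0 //.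
by rewrite divn2 /= uphalf_double.
Qed.

Lemma nth_decode t i : nth 0 (CodeSeq.decode t) i = logn 2 (iter i code_tail t).
Proof.
rewrite -{2}(CodeSeq.decodeK t); elim: i (CodeSeq.decode t) => [|i IH] [|n s].
- by rewrite logn0.
- by rewrite logn_code.
- by rewrite iterSr (_ : code_tail _ = CodeSeq.code [::]) // -IH !nth_nil.
- by rewrite iterSr code_tail_code -IH.
Qed.

Lemma decode_pickle_seq (T : countType) (s : seq T) :
  CodeSeq.decode (pickle s) = [seq pickle x | x <- s].
Proof. exact: CodeSeq.codeK. Qed.

Lemma decode_pickle_pair (S T : countType) (a : S) (b : T) :
  CodeSeq.decode (pickle (a, b)) = [:: pickle a; pickle b].
Proof. exact: CodeSeq.codeK. Qed.

Lemma computable_nth0 X (enc : encoding X) (V : X -> seq nat) i :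
  computable enc V -> computable enc (fun x => nth 0 (V x) i).
Proof.
move=> cV; have ct : computable enc (fun x => iter i code_tail (pickle (V x))).
  by elim: i => [|i IH] //=; rewrite /code_tail; comp.
apply: computable_ext (computable_logn 2 ct) => x.
by rewrite -nth_decode decode_pickle_seq map_id.
Qed.
#[global] Hint Resolve computable_nth0 : comp.

Lemma computable_decode X (enc : encoding X) (G : X -> nat) :
  computable enc G -> computable enc (fun x => CodeSeq.decode (G x)).
Proof.
apply: computable_of_pickle => x.
by apply: (can_inj CodeSeq.decodeK); rewrite decode_pickle_seq map_id.
Qed.
#[global] Hint Resolve computable_decode : comp.

Lemma computable_cons X (enc : encoding X) (T : countType) (G : X -> T) V :
  computable enc G -> computable enc V -> computable enc (fun x => G x :: V x).
Proof.
move=> cG cV; apply: (computable_of_pickle (F := fun x =>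
  2 ^ pickle (G x) * (2 * pickle (V x)).+1)); last by comp.
by move=> x; rewrite mul2n.
Qed.
#[global] Hint Resolve computable_cons : comp.

Lemma computable_map_seq X (enc : encoding X) (I : eqType) (T : countType)
    (s : seq I) (F : I -> X -> T) :
  {in s, forall i, computable enc (F i)} ->
  computable enc (fun x => [seq F i x | i <- s]).
Proof.
elim: s => [_|i s IH cF] /=; first by comp.
apply: computable_cons; first exact/cF/mem_head.
by apply: IH => j js; apply: cF; rewrite inE js orbT.
Qed.

Lemma computable_pair X (enc : encoding X) (S T : countType) (F : X -> S)
    (G : X -> T) :
  computable enc F -> computable enc G -> computable enc (fun x => (F x, G x)).
Proof.
move=> cF cG; apply: computable_of_pickle
  (_ : computable enc (fun x => pickle [:: pickle (F x); pickle (G x)])) => //.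
by comp.
Qed.
#[global] Hint Resolve computable_pair : comp.

Lemma computable_fst X (enc : encoding X) (S T : countType) (F : X -> S * T) :
  computable enc F -> computable enc (fun x => (F x).1).
Proof.
move=> cF; apply: (computable_of_pickle (F := fun x =>
  nth 0 (CodeSeq.decode (pickle (F x))) 0)); last by comp.
by move=> x; case: (F x) => a b; rewrite decode_pickle_pair.
Qed.

Lemma computable_snd X (enc : encoding X) (S T : countType) (F : X -> S * T) :
  computable enc F -> computable enc (fun x => (F x).2).
Proof.
move=> cF; apply: (computable_of_pickle (F := fun x =>
  nth 0 (CodeSeq.decode (pickle (F x))) 1)); last by comp.
by move=> x; case: (F x) => a b; rewrite decode_pickle_pair.
Qed.
#[global] Hint Extern 2 (computable _ (fun _ => fst _)) =>
  apply: computable_fst : comp.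
#[global] Hint Extern 2 (computable _ (fun _ => snd _)) =>
  apply: computable_snd : comp.

Lemma computable_Some X (enc : encoding X) (T : countType) (F : X -> T) :
  computable enc F -> computable enc (fun x => Some (F x)).
Proof.
move=> cF; apply: computable_of_pickle
  (_ : computable enc (fun x => pickle [:: F x])) => //.
by comp.
Qed.
#[global] Hint Resolve computable_Some : comp.

Lemma computable_isSome X (enc : encoding X) (T : countType)
    (F : X -> option T) :
  computable enc F -> computable enc (fun x => isSome (F x)).
Proof.
move=> cF; apply: (computable_ext (F := fun x => 0 < pickle (F x))).
  by move=> x; case: (F x) => //= a; rewrite muln_gt0 expn_gt0.
by comp.
Qed.
#[global] Hint Resolve computable_isSome : comp.

Lemma computable_odflt0 X (enc : encoding X) (F : X -> option nat) :
  computable enc F -> computable enc (fun x => odflt 0 (F x)).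
Proof.
move=> cF; apply: (computable_ext (F := fun x =>
  logn 2 (pickle (F x)))); last by comp.
by move=> x; case: (F x) => [a|]; rewrite ?logn0 //= -[RHS](logn_code a [::]).
Qed.
#[global] Hint Resolve computable_odflt0 : comp.

Lemma computable_omap X (enc : encoding X) (T : countType) (f : nat -> T)
    (F : X -> option nat) :
  computable enc1 f -> computable enc F ->
  computable enc (fun x => omap f (F x)).
Proof.
move=> cf cF; apply: (computable_ext (F := fun x =>
  if isSome (F x) then Some (f (odflt 0 (F x))) else None)).
  by move=> x; case: (F x).
by comp.
Qed.

(* Binary expansion on [l] digits, most significant first; higher digits of [j]
   are dropped. *)
Definition bits (j l : nat) : bstring :=
  iteri l (fun i p => odd (j %/ 2 ^ i) :: p) [::].

Fixpoint bits_val (p : bstring) : nat :=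
  if p is b :: p' then b * 2 ^ size p' + bits_val p' else 0.

Lemma computable_bits X (enc : encoding X) (G H : X -> nat) :
  computable enc G -> computable enc H ->
  computable enc (fun x => bits (G x) (H x)).
Proof. by move=> cG cH; rewrite /bits; comp. Qed.
#[global] Hint Resolve computable_bits : comp.

Lemma size_bits j l : size (bits j l) = l.
Proof. by elim: l => //= l ->. Qed.

Lemma bits_val_lt p : bits_val p < 2 ^ size p.
Proof.
elim: p => //= b p IH; rewrite expnS mul2n -addnn.
by case: b; rewrite ?mul1n ?mul0n ?ltn_add2l // ltn_addl.
Qed.

Lemma bits_val_cat p q :
  bits_val (p ++ q) = bits_val p * 2 ^ size q + bits_val q.
Proof. by elim: p => //= b p ->; rewrite size_cat expnD mulnDl addnA mulnA. Qed.

Lemma bits_mod j l : bits (j %% 2 ^ l) l = bits j l.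
Proof.
suff bits_le l' : l' <= l -> bits (j %% 2 ^ l) l' = bits j l' by exact: bits_le.
elim: l' => //= l' IH l'l; rewrite IH 1?ltnW //; congr (_ :: _).
rewrite -[l in LHS](subnK (ltnW l'l)) expnD -modn_divl odd_mod //.
by rewrite oddX orbF subn_eq0 leqNgt l'l.
Qed.

Lemma bits_val_bits j l : bits_val (bits j l) = j %% 2 ^ l.
Proof.
elim: l => [|l IH] /=; first by rewrite modn1.
rewrite IH size_bits -modn2 [RHS](divn_eq _ (2 ^ l)) expnS -modn_divl.
by rewrite modn_dvdm ?dvdn_mull.
Qed.

Lemma bits_valK p : bits (bits_val p) (size p) = p.
Proof.
elim: p => //= b p IH; congr (_ :: _).
  by rewrite divnMDl ?expn_gt0 // divn_small ?bits_val_lt // addn0 oddb.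
by rewrite -[RHS]IH -bits_mod modnMDl bits_mod.
Qed.

(** * Step-bounded evaluation *)

(* The principle generated by Rocq ignores the codes nested in [RComp]. *)
Lemma recf_seq_ind (P : recf -> Prop) (Q : seq recf -> Prop) :
  P RZero -> P RSucc -> (forall i, P (RProj i)) ->
  (forall f gs, P f -> Q gs -> P (RComp f gs)) ->
  (forall f g, P f -> P g -> P (RPrec f g)) ->
  (forall f, P f -> P (RMin f)) ->
  Q [::] -> (forall g gs, P g -> Q gs -> Q (g :: gs)) -> forall e, P e.
Proof.
move=> P_zero P_succ P_proj P_comp P_prec P_min Q_nil Q_cons.
fix IH 1 => -[||i|f gs|f g|f].
- exact: P_zero.
- exact: P_succ.
- exact: P_proj.
- apply: P_comp; first exact: IH.
  by elim: gs => [//|g gs IHgs]; apply: Q_cons.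
- by apply: P_prec; apply: IH.
- by apply: P_min; apply: IH.
Qed.

(* The unbounded search of [RMin] is cut off at [n]; all else is exact. *)
Fixpoint step (n : nat) (e : recf) (xs : seq nat) {struct e} : option nat :=
  match e with
  | RZero => Some 0
  | RSucc => omap succn (onth xs 0)
  | RProj i => onth xs i
  | RComp f gs =>
      let ys := [seq step n g xs | g <- gs] in
      if all isSome ys then step n f (map (odflt 0) ys) else None
  | RPrec f g =>
      if xs is m :: zs then
        iteri m (fun i r =>
          if isSome r then step n g [:: i, odflt 0 r & zs] else None)
          (step n f zs)
      else None
  | RMin f =>
      let m := find (fun m => odflt 0 (step n f (m :: xs)) == 0) (iota 0 n) in
      if step n f (m :: xs) == Some 0 then Some m else None
  end.

Lemma step_sound n e xs y : step n e xs = Some y -> eval e xs y.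
Proof.
move: e xs y; apply: (recf_seq_ind (Q := fun gs => forall xs,
  let ys := [seq step n g xs | g <- gs] in
  all isSome ys -> evals gs xs (map (odflt 0) ys)))
  => [||i|f gs IHf IHgs|f g IHf IHg|f IHf||g gs IHg IHgs] xs
  => [y|y|y|y|y|y||] /=.
- by case=> <-; exact: eZero.
- by case: xs => // x xs [<-]; exact: eSucc.
- move=> iy; rewrite -(onth_nth 0 _ _ _ iy); apply: eProj.
  by rewrite -onthTE iy.
- by case: ifP => // /IHgs gs_found /IHf; exact: eComp.
- case: xs => // m zs; elim: m y => [|m IHm] y /=.
    by move=> /IHf; exact: ePrec0.
  by case E: (iteri _ _ _) => [r|] //= /IHg; apply: ePrecS; exact: IHm.
- set b := fun m => _; set m := find b _; case: eqP => // fm [<-].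
  apply: eMin => [|j jm]; first exact: IHf.
  have jn : j < n.
    by apply: leq_trans jm _; rewrite -[leqRHS](size_iota 0) find_size.
  have := before_find 0 jm; rewrite nth_iota // add0n /b.
  by case E: (step n f (j :: xs)) => [[|k]|] //= _; exists k; exact: IHf.
- by move=> _; exact: esNil.
- case E: (step n g xs) => [y|] //= /IHgs; apply: esCons; exact: IHg.
Qed.

Lemma eval_comp f gs xs y :
  eval (RComp f gs) xs y -> exists2 ys, evals gs xs ys & eval f ys y.
Proof. by move=> ev; inversion ev as [| | |? ? ? ys| | |]; exists ys. Qed.

Lemma eval_precS f g n xs y : eval (RPrec f g) (n.+1 :: xs) y ->
  exists2 r, eval (RPrec f g) (n :: xs) r & eval g [:: n, r & xs] y.
Proof. by move=> ev; inversion ev as [| | | | |? ? ? ? r|]; exists r. Qed.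

Lemma eval_min f xs n : eval (RMin f) xs n ->
  eval f (n :: xs) 0 /\
  forall m, m < n -> exists k, eval f (m :: xs) k.+1.
Proof. by move=> ev; inversion ev. Qed.

Lemma evals_cons g gs xs ys : evals (g :: gs) xs ys ->
  exists y ys', [/\ ys = y :: ys', eval g xs y & evals gs xs ys'].
Proof. by move=> ev; inversion ev as [|? ? ? y ys']; exists y, ys'. Qed.

Lemma find_iota (b : pred nat) n m :
  m < n -> b m -> (forall j, j < m -> ~~ b j) -> find b (iota 0 n) = m.
Proof.
move=> mn bm bj.
have b_nth i : i < n -> nth 0 (iota 0 n) i = i by move/nth_iota->.
have hasb : has b (iota 0 n) by apply/hasP; exists m; rewrite ?mem_iota.
have find_n : find b (iota 0 n) < n by rewrite -[ltnRHS](size_iota 0) -has_find.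
case: (ltngtP (find b (iota 0 n)) m) => // [/bj|mf].
  by have := nth_find 0 hasb; rewrite b_nth // => ->.
by have := before_find 0 mf; rewrite b_nth ?bm.
Qed.

Lemma step_complete e xs y :
  eval e xs y -> (\forall n \near \oo, step n e xs = Some y)%classic.
Proof.
move: e xs y; apply: (recf_seq_ind (Q := fun gs =>
  forall xs ys, evals gs xs ys ->
  (\forall n \near \oo, [seq step n g xs | g <- gs] = map Some ys)%classic))
  => [||i|f gs IHf IHgs|f g IHf IHg|f IHf||g gs IHg IHgs] xs y ev.
- by inversion ev; subst; exact: nearW.
- by inversion ev; subst; exact: nearW.
- inversion ev as [| |? ? i_lt| | | |]; apply: nearW => n /=.
  by rewrite onthE (nth_map 0).
- have [ys /IHgs gs_found /IHf f_found] := eval_comp ev.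
  apply: filterS2 gs_found f_found => n /= -> <-.
  by rewrite all_map all_predT -map_comp map_id.
- case: xs ev => [|m zs] ev; first by inversion ev.
  elim: m y ev => [|m IHm] y ev.
    inversion ev; subst; exact: IHf.
  have [r /IHm r_found /IHg g_found] := eval_precS ev.
  by apply: filterS2 r_found g_found => n /= -> /=.
- have [/IHf f0 fS] := eval_min ev.
  have {}fS : (\forall n \near \oo, forall j : 'I_y,
      exists k, step n f (val j :: xs) = Some k.+1)%classic.
    apply: filter_forall => j; have [k /IHf] := fS j (ltn_ord j).
    by apply: filterS => n ->; exists k.
  apply: filterS3 (nbhs_infty_gt y) f0 fS => n yn f0 fS /=.
  rewrite (find_iota yn) ?f0 // => j jy.
  by have [k /= ->] := fS (Ordinal jy).
- by inversion ev; subst; apply: nearW.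
- have [z [zs [-> /IHg g_found /IHgs gs_found]]] := evals_cons ev.
  by apply: filterS2 g_found gs_found => n /= -> ->.
Qed.

Lemma eval_fun e xs y z : eval e xs y -> eval e xs z -> y = z.
Proof.
move=> /step_complete y_found /step_complete z_found.
by have [n [-> [->]]] := filter_ex (filterI y_found z_found).
Qed.

Lemma computable_vec_behead X (enc : encoding X) V :
  computable_vec enc V -> computable_vec enc (fun x => behead (V x)).
Proof.
move=> [es esP]; exists (behead es) => x.
case: es esP => [|e es] /(_ x) ev; first by inversion ev; exact: esNil.
by have [y [ys [-> _]]] := evals_cons ev.
Qed.
#[global] Hint Resolve computable_vec_behead : comp.

Lemma computable_onth_encode X (enc : encoding X) i :
  computable enc (fun x => onth (enc x) i).
Proof.
have [ik|ki] := ltnP i (arity enc); last first.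
  apply: computable_ext (computable_const enc (None : option nat)) => x.
  by rewrite onth_default // size_encode.
apply: computable_ext (computable_Some (computable_nth_encode ik)) => x.
by rewrite onthE (nth_map 0) // size_encode.
Qed.

Definition enc_behead X (enc : encoding X) : encoding X :=
  Encoding (fun x =>
    etrans (size_behead (enc x)) (congr1 predn (size_encode enc x))).

Definition step_computable (e : recf) : Prop :=
  forall X (enc : encoding X),
    computable (enc_cons enc) (fun y => step y.1 e (enc y.2)).

Lemma step_computable_prec f g :
  step_computable f -> step_computable g -> step_computable (RPrec f g).
Proof.
move=> cf cg X enc; have [k0|k0] := posnP (arity enc).
  apply: computable_ext (computable_const _ (None : option nat)) => y.
  by rewrite (size0nil (etrans (size_encode enc y.2) k0)).
pose tl := enc_behead enc; have c_head := computable_nth_encode k0.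
have cf' : computable (enc_cons enc) (fun y => step y.1 f (tl y.2)).
  by apply: (computable_comp (h := id) (cf _ tl)) => /=; comp.
have cg' : computable (enc_cons (enc_cons (enc_cons enc)))
    (fun y : nat * (option nat * (nat * X)) =>
       step y.2.2.1 g [:: y.1, odflt 0 y.2.1 & tl y.2.2.2]).
  apply: (computable_comp (cg _ (enc_cons (enc_cons tl)))
    (h := fun y : nat * (option nat * (nat * X)) =>
       (y.2.2.1, (y.1, (odflt 0 y.2.1, y.2.2.2))))) => /=.
  by comp.
apply: (computable_ext (F := fun y => iteri (nth 0 (enc y.2) 0)
  (fun i r => if isSome r then step y.1 g [:: i, odflt 0 r & tl y.2] else None)
  (step y.1 f (tl y.2)))); last by comp.
by move=> y /=; case: (encode enc y.2) (size_encode enc y.2) k0 => //= <-.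
Qed.

Lemma step_computable_min f : step_computable f -> step_computable (RMin f).
Proof.
move=> cf X enc.
have c_at Y (encY : encoding Y) n m V :
    computable encY n -> computable encY m ->
    computable_vec encY (fun y => enc (V y)) ->
    computable encY (fun y => step (n y) f (m y :: enc (V y))).
  move=> cn cm cV; apply: (computable_comp (cf _ (enc_cons enc))
    (h := fun y => (n y, (m y, V y)))) => /=.
  by comp.
pose m (y : nat * X) :=
  find (fun m => odflt 0 (step y.1 f (m :: enc y.2)) == 0) (iota 0 y.1).
have cm : computable (enc_cons enc) m.
  apply: (@computable_find _ _ fst
    (fun m y => odflt 0 (step y.1 f (m :: enc y.2)) == 0)); first by comp.
  by apply: computable_eq; [apply: computable_odflt0; apply: c_at; comp|comp].
apply: (@computable_if _ _ _ (fun y => step y.1 f (m y :: enc y.2) == Some 0)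
  (fun y => Some (m y)) (fun=> None)); [|by comp|by comp].
by apply: computable_eq; [apply: c_at; comp|comp].
Qed.

Lemma computable_step e : step_computable e.
Proof.
move: e; apply: (recf_seq_ind (Q := fun gs => forall X (enc : encoding X),
  computable (enc_cons enc)
    (fun y => all isSome [seq step y.1 g (enc y.2) | g <- gs]) /\
  computable_vec (enc_cons enc)
    (fun y => [seq odflt 0 (step y.1 g (enc y.2)) | g <- gs])))
  => [X enc|X enc|i X enc|f gs IHf IHgs X enc|f g|f|X enc|g gs IHg IHgs X enc]
  /=.
- by comp.
- apply: computable_omap; first by comp.
  exact: computable_weaken (computable_onth_encode enc 0).
- exact: computable_weaken (computable_onth_encode enc i).
- have [c_all c_vec] := IHgs X enc.
  pose enc' : encoding (nat * X) := @Encoding _ (size gs)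
    (fun y => [seq odflt 0 (step y.1 g (enc y.2)) | g <- gs])
    (fun=> size_map _ _).
  apply: (computable_if c_all); last by comp.
  apply: (computable_ext (F := fun y => step y.1 f (enc' y))).
    by move=> y; rewrite -map_comp.
  by apply: (computable_comp (h := fun y => (y.1, y)) (IHf _ enc')) => /=; comp.
- exact: step_computable_prec.
- exact: step_computable_min.
- by split; comp.
- by have cg := IHg X enc; have [c_all c_vec] := IHgs X enc; split; comp.
Qed.

Lemma computable_minimize (S : countType) (b : nat -> S -> bool) :
  computable (enc_cons enc1) (fun y => b y.1 y.2) ->
  exists e, forall x t, eval e [:: pickle x] t <->
    b t x /\ forall u, u < t -> ~~ b u x.
Proof.
move=> /computable_negb[e eP].
have evP u x : eval e [:: u; pickle x] (~~ b u x) by exact: (eP (u, x)).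
exists (RMin e) => x t; split=> [/eval_min[ev0 evS]|[bt bu]].
  split=> [|u /evS[k evk]].
    by have := eval_fun (evP t x) ev0; case: (b t x).
  by have := eval_fun (evP u x) evk; case: (b u x).
apply: eMin => [|u /bu ub]; first by have := evP t x; rewrite bt.
by exists 0; have := evP u x; rewrite ub.
Qed.

Definition first_match (b : nat -> bstring -> bool) (h : nat -> bstring)
    (p : bstring) : option bstring :=
  match pselect (exists t, b t p) with
  | left ex => Some (h (ex_minn ex))
  | right _ => None
  end.

Lemma first_matchP b h p s : first_match b h p = Some s <->
  exists t, [/\ b t p, forall u, u < t -> ~~ b u p & s = h t].
Proof.
rewrite /first_match; case: pselect => [ex|nex]; last first.
  by split=> [//|[t [bt _ _]]]; case: nex; exists t.
case: ex_minnP => t bt t_min; split=> [[<-]|[u [bu u_min ->]]].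
  by exists t; split=> // u; rewrite ltnNge; apply: contra => /t_min.
congr (Some (h _)); apply/eqP; rewrite eqn_leq t_min //= leqNgt.
by apply/negP => /u_min; rewrite bt.
Qed.

Lemma first_match_partial_recursive b h :
  computable (enc_cons enc1) (fun y => b y.1 y.2) -> computable enc1 h ->
  partial_recursive (first_match b h).
Proof.
move=> /computable_minimize[e eP] [f fP]; exists (RComp f [:: e]) => p y.
split=> [/eval_comp[ts /evals_cons[t [ts' [-> /eP[bt t_min] ev_nil]]] ev_h]|].
  inversion ev_nil; subst; rewrite -(eval_fun (fP t) ev_h).
  by exists (h t); split=> //; apply/first_matchP; exists t.
move=> [s [/first_matchP[t [bt t_min ->]] ->]]; apply: eComp (fP t).
by apply: esCons; [apply/eP|exact: esNil].
Qed.

(** * The Kraft-Chaitin theorem *)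

Local Open Scope ring_scope.

Definition divn_up (a d : nat) : nat := ((a + d.-1) %/ d)%N.

Lemma divn_upP a d : (0 < d)%N -> (a <= divn_up a d * d < a + d)%N.
Proof.
move=> d0; have := divn_eq (a + d.-1) d; have := ltn_pmod (a + d.-1) d0.
by rewrite /divn_up => *; apply/andP; split; lia.
Qed.

Lemma pow2V_halve (K : numFieldType) n : (2 : K) ^- n = 2 ^- n.+1 + 2 ^- n.+1.
Proof. by rewrite exprS invfM -mulrDl -[2^-1]div1r -splitr mul1r. Qed.

Lemma pow2V_gt0 (K : numFieldType) n : 0 < (2 : K) ^- n.
Proof. by rewrite invr_gt0 exprn_gt0. Qed.

Lemma pow2V_ge0 (K : numFieldType) n : 0 <= (2 : K) ^- n.
Proof. exact/ltW/pow2V_gt0. Qed.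

(* The left end of the interval of the reals in [0, 1] whose binary expansion
   starts with [p]; its length is [2 ^- size p]. *)
Definition dyadic (K : numFieldType) (p : bstring) : K :=
  (bits_val p)%:R / 2 ^+ size p.

Lemma dyadic_prefix (K : numFieldType) p q : prefix p q ->
  dyadic K p <= dyadic K q < dyadic K p + 2 ^- size p.
Proof.
move=> /prefixP[r ->].
have -> : dyadic K (p ++ r) = dyadic K p + dyadic K r * 2 ^- size p.
  rewrite /dyadic bits_val_cat size_cat natrD natrM natrX exprD.
  by field; rewrite !expf_neq0 // pnatr_eq0.
rewrite /dyadic lerDl ltrD2l mulr_ge0 ?divr_ge0 ?pow2V_ge0 ?exprn_ge0 //=.
rewrite gtr_pMl ?pow2V_gt0 // ltr_pdivrMr ?exprn_gt0 // mul1r -natrX ltr_nat.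
exact: bits_val_lt.
Qed.

Section KraftChaitin.

Variables (active : nat -> bool) (len : nat -> nat).

(* Each active request [t] is allotted the interval of length [2 ^- len t] that
   follows those of the earlier ones.  It starts at [used t / 2 ^ depth t], and
   [word t] spells the leftmost dyadic interval of half its length inside. *)
Definition depth (t : nat) : nat := (\sum_(0 <= i < t) len i)%N.
Definition used (t : nat) : nat :=
  (\sum_(0 <= i < t) active i * 2 ^ (depth t - len i))%N.
Definition slot (t : nat) : nat :=
  divn_up (used t * 2 ^ (len t).+1) (2 ^ depth t).
Definition word (t : nat) : bstring := bits (slot t) (len t).+1.

Lemma computable_word :
  computable enc1 active -> computable enc1 len -> computable enc1 word.
Proof.
move=> c_active c_len.
have c_depth : computable enc1 depth by rewrite /depth; comp.
have c_used : computable enc1 used by rewrite /used; comp.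
by rewrite /word /slot /divn_up; comp.
Qed.

Variable K : realFieldType.
Hypothesis budget :
  forall t, \sum_(0 <= i < t | active i) (2 : K) ^- len i <= 1.

Let left_end (t : nat) : K := \sum_(0 <= i < t | active i) 2 ^- len i.

Lemma left_endS t : active t -> left_end t.+1 = left_end t + 2 ^- len t.
Proof.
by move=> At; rewrite /left_end big_mkcond big_nat_recr //= At -big_mkcond.
Qed.

Lemma left_end_homo : {homo left_end : t u / (t <= u)%N >-> t <= u}.
Proof.
apply: homo_leq => // [t u v|t]; first exact: le_trans.
rewrite /left_end [leRHS]big_mkcond big_nat_recr //= -big_mkcond lerDl.
by case: ifP; rewrite ?pow2V_ge0.
Qed.

Lemma leq_depth t i : (i < t)%N -> (len i <= depth t)%N.
Proof.
by move=> it; rewrite /depth big_mkord (bigD1 (Ordinal it)) //= leq_addr.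
Qed.

Lemma left_endE t : left_end t = (used t)%:R / (2 ^ depth t)%:R.
Proof.
rewrite /left_end /used natr_sum mulr_suml big_mkcond.
apply: eq_big_nat => i /andP[_ it].
case: ifP => _; rewrite ?mul0n ?mul0r // mul1n !natrX.
rewrite -[X in _ / _ ^+ X](subnK (leq_depth it)) exprD invfM mulrA.
by rewrite divff ?mul1r.
Qed.

Lemma slot_bounds t :
  left_end t <= (slot t)%:R / 2 ^+ (len t).+1 < left_end t + 2 ^- (len t).+1.
Proof.
have D0 : (0 < 2 ^ depth t)%N by rewrite expn_gt0.
have /andP[le_slot slot_lt] := divn_upP (used t * 2 ^ (len t).+1) D0.
rewrite left_endE -(natrX K 2 _.+1).
set L := (2 ^ (len t).+1)%N in le_slot slot_lt *.
have L0R : 0 < (L%:R : K) by rewrite ltr0n expn_gt0.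
have D0R : 0 < ((2 ^ depth t)%:R : K) by rewrite ltr0n.
rewrite ler_pdivrMr // mulrAC ler_pdivlMr // -!natrM ler_nat le_slot /=.
rewrite ltr_pdivrMr // mulrDl mulVf ?gt_eqF // mulrAC -(ltr_pM2r D0R) mulrDl.
by rewrite mul1r divfK ?gt_eqF // -!natrM -natrD ltr_nat.
Qed.

Lemma word_interval t : active t ->
  left_end t <= dyadic K (word t) /\
  dyadic K (word t) + 2 ^- size (word t) <= left_end t.+1.
Proof.
move=> At; have /andP[le_slot slot_lt] := slot_bounds t.
have le1 : left_end t + 2 ^- len t <= 1 by rewrite -left_endS //; exact: budget.
have slot_small : (slot t < 2 ^ (len t).+1)%N.
  rewrite -(ltr_nat K) natrX -[ltRHS]mul1r -ltr_pdivrMr ?exprn_gt0 //.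
  apply: (lt_le_trans slot_lt); apply: le_trans le1.
  by rewrite lerD2l (pow2V_halve _ (len t)) lerDl pow2V_ge0.
rewrite /dyadic bits_val_bits size_bits modn_small // left_endS //; split=> //.
by rewrite (pow2V_halve _ (len t)) addrA lerD2r ltW.
Qed.

Lemma word_prefix t u :
  active t -> active u -> prefix (word t) (word u) -> t = u.
Proof.
move=> At Au /(dyadic_prefix K)/andP[tu ut].
have [t1 t2] := word_interval At; have [u1 u2] := word_interval Au.
case: (ltngtP t u) => // /left_end_homo le_tu.
  by have := lt_le_trans ut (le_trans t2 (le_trans le_tu u1)); rewrite ltxx.
have := le_trans u2 (le_trans le_tu (le_trans t1 tu)).
by rewrite gerDl leNgt pow2V_gt0.
Qed.

Theorem kraft_chaitin (out : nat -> bstring) :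
  computable enc1 active -> computable enc1 len -> computable enc1 out ->
  exists2 C, computer C &
    forall t, active t -> exists2 p, C p = Some (out t) & size p = (len t).+1.
Proof.
move=> c_active c_len c_out; pose matches t p := active t && (word t == p).
exists (first_match matches out); first split.
- apply: first_match_partial_recursive c_out; rewrite /matches.
  by have c_word := computable_word c_active c_len; comp.
- move=> p q; case Cp: first_match => [s|] // _.
  case Cq: first_match => [s'|] // _.
  have [t [/andP[At /eqP <-] _ _]] := (first_matchP _ _ _ _).1 Cp.
  have [u [/andP[Au /eqP <-] _ _]] := (first_matchP _ _ _ _).1 Cq.
  by move=> /(word_prefix At Au) ->.
- move=> t At; exists (word t); last exact: size_bits.
  apply/first_matchP; exists t; split=> [|u ut|//].
    by rewrite /matches At eqxx.
  apply/negP => /andP[Au /eqP wu].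
  by move: ut; rewrite (word_prefix Au At) ?ltnn // wu prefix_refl.
Qed.

End KraftChaitin.

(** * The coding theorem *)

Definition semimeasure (K : numDomainType) (m : bstring -> K) : Prop :=
  (forall s, 0 <= m s) /\ forall S, uniq S -> \sum_(s <- S) m s <= 1.

(* Only the powers of two below [m s] are enumerated, which gives [m] up to a
   factor of two. *)
Definition lower_semicomputable (K : numFieldType) (m : bstring -> K) : Prop :=
  exists2 test : nat -> nat -> bstring -> bool,
    computable (enc_cons (enc_cons enc1)) (fun y => test y.1 y.2.1 y.2.2) &
    forall k s, 2 ^- k < m s <-> exists n, test n k s.

Lemma ler_sum_subset (K : numDomainType) (T : eqType) (s t : seq T)
    (F : T -> K) :
  uniq s -> uniq t -> {subset s <= t} -> (forall x, 0 <= F x) ->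
  \sum_(x <- s) F x <= \sum_(x <- t) F x.
Proof.
move=> us ut st F0; have ps : perm_eq s [seq x <- t | x \in s].
  apply: uniq_perm; rewrite ?filter_uniq // => x.
  by rewrite mem_filter andb_idr // => /st.
rewrite (perm_big _ ps) big_filter [leRHS](bigID (mem s)) /= lerDl.
by rewrite sumr_ge0.
Qed.

Lemma sum_pow2V_below (K : realFieldType) (x : K) B : 0 <= x ->
  \sum_(0 <= k < B | 2 ^- k < x) (2 : K) ^- k.+1 <= x.
Proof.
move=> x0; suff : \sum_(0 <= k < B | 2 ^- k < x) (2 : K) ^- k.+1 <=
    Num.max 0 (x - 2 ^- B).
  by move=> /le_trans; apply; rewrite ge_max x0 gerBl pow2V_ge0.
elim: B => [|B IH]; first by rewrite big_nil le_max lexx.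
rewrite big_mkcond big_nat_recr //= -big_mkcond /=.
case: ltP => [Bx|xB]; last first.
  rewrite addr0; apply: le_trans IH _.
  by rewrite ge_max !le_max lexx subr_le0 xB.
apply: le_trans (lerD IH (lexx _)) _.
rewrite (max_idPr _) ?subr_ge0 ?(ltW Bx) //.
by rewrite le_max (pow2V_halve _ B) opprD addrA subrK lexx orbT.
Qed.

Lemma sum_pow2V (K : numFieldType) n :
  \sum_(0 <= k < n) (2 : K) ^- k.+1 = 1 - 2 ^- n.
Proof.
elim: n => [|n IH]; first by rewrite big_nil expr0 invr1 subrr.
by rewrite big_nat_recr //= IH (pow2V_halve _ n) opprD addrA subrK.
Qed.

Lemma sum_pow2V_uniq_le1 (K : realFieldType) (s : seq nat) :
  uniq s -> \sum_(k <- s) (2 : K) ^- k.+1 <= 1.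
Proof.
move=> us; pose B := (\max_(k <- s) k).+1.
apply: (@le_trans _ _ (\sum_(0 <= k < B) 2 ^- k.+1)); last first.
  by rewrite sum_pow2V gerBl pow2V_ge0.
apply: ler_sum_subset => // [|k ks]; first exact: iota_uniq.
by rewrite mem_index_iota ltnS (@leq_bigmax_seq _ _ xpredT id).
Qed.

Section Requests.

Variables (K : realFieldType) (m : bstring -> K).
Hypothesis m_semimeasure : semimeasure m.

Lemma requests_le1 (Q : seq (bstring * nat)) :
  uniq Q -> {in Q, forall q, 2 ^- q.2 < m q.1} ->
  \sum_(q <- Q) (2 : K) ^- q.2.+1 <= 1.
Proof.
move=> uQ Qm; have [m0 m1] := m_semimeasure.
pose S := undup [seq q.1 | q <- Q]; pose B := (\max_(q <- Q) q.2).+1.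
pose T := [seq q <- [seq (s, k) | s <- S, k <- index_iota 0 B]
             | 2 ^- q.2 < m q.1].
have uT : uniq T.
  apply/filter_uniq/allpairs_uniq; rewrite ?undup_uniq ?iota_uniq //.
  by move=> [s k] [s' k'].
have QT : {subset Q <= T}.
  move=> q qQ; rewrite mem_filter Qm //; apply/allpairsP; exists q.
  split; [by rewrite mem_undup map_f| |by case: q {qQ}].
  by rewrite mem_index_iota ltnS (@leq_bigmax_seq _ _ xpredT (fun q => q.2)).
apply: le_trans (ler_sum_subset uQ uT QT _) _ => [q|]; first exact: pow2V_ge0.
rewrite big_filter big_mkcond big_allpairs.
apply: le_trans (m1 _ (undup_uniq _)); apply: ler_sum => s _.
by have := sum_pow2V_below B (m0 s); rewrite [leLHS]big_mkcond.
Qed.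

Variable test : nat -> nat -> bstring -> bool.
Hypothesis test_computable :
  computable (enc_cons (enc_cons enc1)) (fun y => test y.1 y.2.1 y.2.2).
Hypothesis test_below : forall n k s, test n k s -> 2 ^- k < m s.

(* The code [t] of a sequence [n, k, j, l] requests a program of length about
   [k] for the string [bits j l], provided the test succeeds at time [n]. *)
Let field (i t : nat) : nat := nth 0%N (CodeSeq.decode t) i.
Let request (t : nat) : bstring * nat :=
  (bits (field 2 t) (field 3 t), field 1 t).
Let raised (t : nat) : bool := test (field 0 t) (request t).2 (request t).1.
Let fresh (t : nat) : bool :=
  raised t &&
  all (fun u => ~~ (raised u && (request u == request t))) (iota 0 t).

Lemma computable_fresh : computable enc1 fresh.
Proof.
have c_request : computable enc1 request by rewrite /request /field; comp.
have c_raised : computable enc1 raised.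
  apply: (computable_comp (h := fun t =>
    (field 0 t, ((request t).2, (request t).1))) test_computable) => /=.
  by rewrite /request /field /=; comp.
by rewrite /fresh; comp.
Qed.

Lemma fresh_inj : {in fresh &, injective request}.
Proof.
move=> t u; wlog tu : t u / (t < u)%N => [wl ft fu rtu|].
  case: (ltngtP t u) => // lt_tu; first exact: wl lt_tu ft fu rtu.
  by rewrite (wl u t lt_tu fu ft (esym rtu)).
move=> /andP[rt _] /andP[_ /allP/(_ t)].
by rewrite mem_iota tu rt => /(_ isT) /= /eqP.
Qed.

Lemma fresh_request n k s :
  test n k s -> exists2 t, fresh t & request t = (s, k).
Proof.
move=> test_s; pose asked t := raised t && (request t == (s, k)).
have ex : exists t, asked t.
  exists (CodeSeq.code [:: n; k; bits_val s; size s]).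
  rewrite /asked /raised /request /field CodeSeq.codeK /=.
  by rewrite bits_valK test_s eqxx.
case: (ex_minnP ex) => t /andP[rt /eqP tE] t_min; exists t => //.
rewrite /fresh rt; apply/allP => u; rewrite mem_iota tE => /andP[_ ut].
by apply/negP => /t_min; rewrite leqNgt -[t]add0n ut.
Qed.

Lemma fresh_budget t :
  \sum_(0 <= i < t | fresh i) (2 : K) ^- (request i).2.+1 <= 1.
Proof.
rewrite -big_filter -(big_map request xpredT (fun q => 2 ^- q.2.+1)).
apply: requests_le1 => [|q /mapP[u]].
  rewrite map_inj_in_uniq ?filter_uniq ?iota_uniq // => i j.
  rewrite !mem_filter => /andP[fi _] /andP[fj _]; exact: fresh_inj.
by rewrite mem_filter => /andP[/andP[/test_below ri _] _] ->.
Qed.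

Lemma computer_of_test : exists2 C, computer C &
  forall n k s, test n k s -> exists2 p, C p = Some s & size p = k.+2.
Proof.
have c_request : computable enc1 request by rewrite /request /field; comp.
have [||C compC progC] := kraft_chaitin fresh_budget
  (out := fun t => (request t).1) computable_fresh; [by comp|by comp|].
exists C => // n k s /fresh_request[t /progC].
by rewrite /request /= => prog [<- <-].
Qed.

End Requests.

Lemma optimal_short_programs (K : realFieldType) U (m : bstring -> K) :
  optimal U -> semimeasure m -> lower_semicomputable m ->
  exists c : nat, forall s k, 2 ^- k < m s ->
    exists2 p, U p = Some s & (size p <= k + c)%N.
Proof.
move=> [_ optU] m_semi [test test_comp m_test].
have below n k s : test n k s -> 2 ^- k < m s.
  by move=> ts; apply/m_test; exists n.
have [C compC progC] := computer_of_test m_semi test_comp below.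
have [sim simP] := optU C compC; exists sim.+2 => s k /m_test[n].
move=> /progC[p /simP[p' [Up' sp']] sp]; exists p' => //.
by rewrite (leq_trans sp') // sp !addSn !addnS.
Qed.

Lemma optimal_surjective U s : optimal U -> exists p, U p = Some s.
Proof.
move=> optU; pose m (t : bstring) : rat := 2 ^- (pickle t).+1.
have [||c prog] := optimal_short_programs optU (m := m).
- split=> [t|S uS]; first exact: pow2V_ge0.
  rewrite -(big_map pickle xpredT (fun k => 2 ^- k.+1)).
  by rewrite sum_pow2V_uniq_le1 // map_inj_uniq //; exact: pcan_inj pickleK.
- exists (fun _ k t => (pickle t).+1 < k)%N; first by comp.
  move=> k t; rewrite /m ltf_pV2 ?posrE ?exprn_gt0 // ltr_eXn2l ?ltr1n //.
  by split=> [|[_]]; first by exists 0%N.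
have [|p Up _] := prog s (pickle s).+2; last by exists p.
by rewrite /m ltf_pV2 ?posrE ?exprn_gt0 // ltr_eXn2l ?ltr1n.
Qed.

Lemma KcP U s : (exists p, U p = Some s) ->
  (exists2 p, U p = Some s & size p = Kc U s) /\
  (forall p, U p = Some s -> (Kc U s <= size p)%N).
Proof.
move=> [p Up]; rewrite /Kc; case: pselect => [ex|[]]; last first.
  by exists (size p); apply/asboolP; exists p.
case: ex_minnP => k /asboolP[q [sq Uq]] k_min; split; first by exists q.
by move=> r Ur; apply: k_min; apply/asboolP; exists r.
Qed.

Theorem coding_theorem (K : realFieldType) U (m : bstring -> K) :
  optimal U -> semimeasure m -> lower_semicomputable m ->
  exists c : nat, forall s, m s <= 2 ^+ c * 2 ^- Kc U s.
Proof.
move=> optU m_semi m_lower.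
have [c prog] := optimal_short_programs optU m_semi m_lower.
exists c.+1 => s; have [_ K_min] := KcP (optimal_surjective s optU).
have m_le1 : m s <= 1 by have := m_semi.2 [:: s] isT; rewrite big_seq1.
have [K_le|c_lt] := leqP (Kc U s) c.+1.
  apply: le_trans m_le1 _.
  by rewrite ler_pdivlMr ?exprn_gt0 // mul1r ler_eXn2l ?ltr1n.
rewrite leNgt; apply/negP => lt_m.
have [|p Up sp] := prog s (Kc U s - c.+1)%N.
  apply: le_lt_trans lt_m; rewrite -[in leRHS](subnK (ltnW c_lt)) exprD invfM.
  by rewrite mulrCA divff ?mulr1 // expf_neq0.
by have := leq_trans (K_min _ Up) sp; lia.
Qed.

(** * Computing with rational matrices *)

Definition pos_part (z : int) : nat := if z is Posz n then n else 0%N.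

Lemma computable_pos_part X (enc : encoding X) (Z : X -> int) :
  computable enc Z -> computable enc (fun x => pos_part (Z x)).
Proof.
move=> cZ; apply: (computable_ext (F := fun x =>
  nth 0 (CodeSeq.decode (nth 0 (CodeSeq.decode (pickle (Z x))) 0)) 0)%N);
  last by comp.
move=> x; case: (Z x) => n.
  rewrite (_ : pickle (Posz n) = CodeSeq.code [:: CodeSeq.code [:: n]; 0%N]) //.
  by rewrite !CodeSeq.codeK.
rewrite (_ : pickle (Negz n) = CodeSeq.code [:: 0%N; CodeSeq.code [:: n]]) //.
by rewrite CodeSeq.codeK.
Qed.
#[global] Hint Resolve computable_pos_part : comp.

Lemma computable_Posz X (enc : encoding X) (G : X -> nat) :
  computable enc G -> computable enc (fun x => Posz (G x)).
Proof.
move=> cG; apply: (computable_of_pickle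
  (F := fun x => pickle [:: pickle [:: G x]; 0%N])) => //.
by comp.
Qed.
#[global] Hint Resolve computable_Posz : comp.

Lemma pickle_rat (q : rat) : pickle q = pickle (numq q, denq q).
Proof. by case: q => -[]. Qed.

Lemma computable_numq_denq X (enc : encoding X) (q : X -> rat) :
  computable enc q -> computable enc (fun x => (numq (q x), denq (q x))).
Proof. by move=> [e eP]; exists e => x; rewrite -pickle_rat; exact: eP. Qed.

Lemma computable_pow2V_lt X (enc : encoding X) (G : X -> nat) (q : X -> rat) :
  computable enc G -> computable enc q ->
  computable enc (fun x => 2 ^- G x < q x).
Proof.
move=> cG /computable_numq_denq c_nd.
have cn := computable_fst c_nd; have cd := computable_snd c_nd.
apply: (computable_ext (F := fun x =>
  pos_part (denq (q x)) < pos_part (numq (q x)) * 2 ^ G x)%N); last by comp.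
move=> x; rewrite -[q x in RHS]divq_num_den; have := denq_gt0 (q x).
case: (denq (q x)) => // d d0; rewrite ltr_pdivlMr ?ltr0z // mulrC.
rewrite -(@ltr_pM2r _ (2 ^+ G x)) ?exprn_gt0 // mulfVK ?expf_neq0 //.
case: (numq (q x)) => n; first by rewrite -!pmulrn -natrX -natrM ltr_nat.
rewrite mul0n ltn0 NegzE mulrNz mulNr; apply/esym/negbTE; rewrite -leNgt.
by rewrite (@le_trans _ _ 0) ?oppr_le0 ?mulr_ge0 ?exprn_ge0 ?ler0z.
Qed.

Lemma numq_denq_ratio (a b : nat) : (0 < b)%N ->
  (numq (a%:R / b%:R), denq (a%:R / b%:R)) =
  (Posz (a %/ gcdn a b), Posz (b %/ gcdn a b)).
Proof.
move=> b0; set g := gcdn a b.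
have g0 : (0 < g)%N by rewrite gcdn_gt0 b0 orbT.
have b'0 : (0 < b %/ g)%N by rewrite divn_gt0 // dvdn_leq // dvdn_gcdr.
have -> : a%:R / b%:R = ((a %/ g)%N%:Z)%:~R / ((b %/ g)%N%:Z)%:~R :> rat.
  apply/eqP; rewrite -!pmulrn eqr_div ?pnatr_eq0 -?lt0n // -!natrM eqr_nat.
  by rewrite muln_divA ?dvdn_gcdr // divn_mulAC ?dvdn_gcdl.
have cop : coprime `|Posz (a %/ g)| `|Posz (b %/ g)|.
  rewrite /= /coprime -(eqn_pmul2r g0) mul1n muln_gcdl.
  by rewrite !divnK ?dvdn_gcdl ?dvdn_gcdr.
rewrite coprimeq_num // coprimeq_den // gtr0_sg ?ltz_nat // mul1r.
by rewrite eqz_nat eqn0Ngt b'0.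
Qed.

Lemma computable_ratio X (enc : encoding X) (G H : X -> nat) :
  computable enc G -> computable enc H ->
  computable enc (fun x => (G x)%:R / (H x)%:R : rat).
Proof.
move=> cG cH; apply: (computable_of_pickle (F := fun x =>
  let g := gcdn (G x) (H x) in
  if 0 < H x then pickle (Posz (G x %/ g), Posz (H x %/ g))
  else pickle (0 : rat))%N); last by comp.
move=> x; case: posnP => [->|H0]; first by rewrite invr0 mulr0.
by rewrite pickle_rat numq_denq_ratio.
Qed.

Lemma pickle_mx (T : countType) m n (A : 'M[T]_(m, n)) :
  pickle A = pickle [seq (ij, A ij.1 ij.2) | ij <- enum {: 'I_m * 'I_n}].
Proof.
transitivity (CodeSeq.code (map pickle (tval (tfgraph (mx_val A))))) => //.
rewrite -codom_tffun /codom /image_mem -map_comp.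
apply: (can_inj CodeSeq.decodeK).
rewrite CodeSeq.codeK decode_pickle_seq -[RHS]map_comp.
by apply: eq_map => -[i j].
Qed.

Lemma computable_mx X (enc : encoding X) (T : countType) m n
    (A : X -> 'M[T]_(m, n)) :
  (forall i j, computable enc (fun x => A x i j)) -> computable enc A.
Proof.
move=> cA; apply: computable_of_pickle (fun x => pickle_mx (A x)) _.
apply: computable_pickle; apply: computable_map_seq => ij _.
by apply: computable_pair; [comp|exact: cA].
Qed.

Lemma computable_mx_entry X (enc : encoding X) (T : countType) m n
    (A : X -> 'M[T]_(m, n)) i j :
  computable enc A -> computable enc (fun x => A x i j).
Proof.
move=> cA; apply: (computable_of_pickle (F := fun x =>
  nth 0 (CodeSeq.decode (nth 0 (CodeSeq.decode (pickle (A x)))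
    (index (i, j) (enum {: 'I_m * 'I_n})))) 1)%N); last by comp.
move=> x; rewrite pickle_mx.
rewrite decode_pickle_seq -map_comp (nth_map (i, j)) ?index_mem ?mem_enum //.
by rewrite nth_index ?mem_enum //= decode_pickle_pair.
Qed.

(** * Algorithmic probability *)

Definition prefix_free_seq (L : seq bstring) : Prop :=
  {in L &, forall p q, prefix p q -> p = q}.

Definition tails (b : bool) (L : seq bstring) : seq bstring :=
  [seq behead p | p <- L & ohead p == Some b].

Lemma mem_tails b L p : (p \in tails b L) = (b :: p \in L).
Proof.
apply/mapP/idP => [[[|c q]]|pL].
- by rewrite mem_filter.
- by rewrite mem_filter => /andP[/eqP[->] qL] ->.
- by exists (b :: p); rewrite ?mem_filter ?eqxx.
Qed.

Lemma tails_uniq b L : uniq L -> uniq (tails b L).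
Proof.
move=> uL; rewrite map_inj_in_uniq ?filter_uniq // => -[|c p] [|d q];
  by rewrite !mem_filter //= => /andP[/eqP[->] _] /andP[/eqP[->] _] ->.
Qed.

Lemma tails_prefix_free b L : prefix_free_seq L -> prefix_free_seq (tails b L).
Proof.
move=> pf p q; rewrite !mem_tails => pL qL pq.
by have := pf _ _ pL qL; rewrite /= eqxx => /(_ pq)[].
Qed.

Lemma sum_pow2V_tails (K : numFieldType) L : [::] \notin L ->
  \sum_(p <- L) (2 : K) ^- size p =
  2^-1 * \sum_(p <- tails true L) 2 ^- size p +
  2^-1 * \sum_(p <- tails false L) 2 ^- size p.
Proof.
elim: L => [|p L IH]; first by rewrite !big_nil mulr0 addr0.
rewrite inE negb_or => /andP[p0 /IH{}IH]; rewrite big_cons IH.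
by case: p p0 => [|[] p] //= _; rewrite /tails /= big_cons exprS invfM mulrDr;
  [rewrite addrA|rewrite addrCA].
Qed.

Theorem kraft_inequality (K : realFieldType) (L : seq bstring) :
  uniq L -> prefix_free_seq L -> \sum_(p <- L) (2 : K) ^- size p <= 1.
Proof.
have [n] : exists n, {in L, forall p, size p < n}%N.
  exists (\max_(p <- L) size p).+1 => p pL; rewrite ltnS.
  exact: (@leq_bigmax_seq _ _ xpredT).
elim: n L => [|n IH] L szL uL pf.
  by case: L szL {uL pf} => [_|p L /(_ p (mem_head _ _))]; rewrite ?big_nil.
have [nilL|nilL] := boolP ([::] \in L).
  have all_nil : {subset L <= [:: [::]]}.
    by move=> p pL; rewrite inE -(pf _ _ nilL pL (prefix0s _)).
  apply: le_trans (ler_sum_subset uL _ all_nil _) _ => //.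
  by rewrite big_seq1 expr0 invr1.
rewrite sum_pow2V_tails // -mulrDr mulrC ler_pdivrMr ?ltr0n // mul1r.
by apply: lerD; apply: IH (tails_uniq _ uL) (tails_prefix_free pf) => p;
  rewrite mem_tails => /szL.
Qed.

Section AlgorithmicProbability.

Variables (R : realType) (U : bstring -> option bstring).
Hypothesis U_prefix_free : prefix_free_dom U.
Implicit Types (s : bstring) (L : seq bstring).

Lemma program_sum_le1 L :
  uniq L -> {in L, forall p, U p <> None} ->
  \sum_(p <- L) (2 : R) ^- size p <= 1.
Proof.
move=> uL UL; apply: kraft_inequality => // p q pL qL.
by apply: U_prefix_free; exact: UL.
Qed.

Lemma Pu_fin_num s :
  (\esum_(p in [set p : bstring | U p = Some s]) ((2 : R) ^- size p)%:E
     \is a fin_num)%E.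
Proof.
rewrite ge0_fin_numE; last by apply: esum_ge0 => p _; rewrite lee_fin.
apply: (@le_lt_trans _ _ 1%E); last by rewrite ltry.
apply: ge_ereal_sup => _ [A [finA AS] <-].
rewrite fsbig_finite // sumEFin lee_fin; apply: program_sum_le1.
  exact: finmap.fset_uniq.
by move=> p; rewrite in_fset_set // inE => /AS /= ->.
Qed.

Lemma Pu_ge L s : uniq L -> {in L, forall p, U p = Some s} ->
  \sum_(p <- L) 2 ^- size p <= Pu R U s.
Proof.
move=> uL UL; rewrite -lee_fin /Pu fineK ?Pu_fin_num //.
apply: esum_ge; exists [set` L]%classic.
  by split; [exact: finite_seq|move=> p /= /UL].
by rewrite -fsbig_seq // sumEFin.
Qed.

Lemma Pu_ge0 s : 0 <= Pu R U s.
Proof. by have := @Pu_ge [::] s isT; rewrite big_nil; apply. Qed.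

Lemma Pu_approx s e : 0 < e -> exists L,
  [/\ uniq L, {in L, forall p, U p = Some s} &
      Pu R U s - e < \sum_(p <- L) 2 ^- size p].
Proof.
move=> e0; have [_ [A [finA AS] <-]] := ub_ereal_sup_adherent e0 (Pu_fin_num s).
rewrite -/(esum _ _) -(fineK (Pu_fin_num s)) fsbig_finite // sumEFin.
rewrite -EFinB lte_fin => lt_sum.
exists (finmap.enum_fset (fset_set A)); split=> //.
  exact: finmap.fset_uniq.
by move=> p; rewrite in_fset_set // inE => /AS.
Qed.

Lemma semimeasure_Pu : semimeasure (Pu R U).
Proof.
split=> [|S uS]; first exact: Pu_ge0.
suff sum_le1 L :
    uniq L -> {in L, forall p, exists2 t, U p = Some t & t \notin S} ->
    \sum_(p <- L) 2 ^- size p + \sum_(s <- S) Pu R U s <= 1.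
  by have := sum_le1 [::] isT; rewrite big_nil add0r; apply.
elim: S uS L => [_|s S IH /= /andP[sS uS]] L uL UL.
  rewrite big_nil addr0; apply: program_sum_le1 uL _ => p /UL[t -> //].
rewrite big_cons; apply/ler_addgt0Pr => e /(Pu_approx s)[L' [uL' UL' PL']].
have uLL' : uniq (L ++ L').
  rewrite cat_uniq uL uL' andbT; apply/hasPn => p /UL' Up; apply/negP => /UL[t].
  by rewrite Up => -[<-]; rewrite inE eqxx.
have /(IH uS _ uLL') :
    {in L ++ L', forall p, exists2 t, U p = Some t & t \notin S}.
  move=> p; rewrite mem_cat => /orP[/UL[t Ut]|/UL' Up]; last by exists s.
  by rewrite inE negb_or => /andP[_ tS]; exists t.
rewrite big_cat /=; lra.
Qed.

Lemma pow2V_Kc_le_Pu s : (exists p, U p = Some s) -> 2 ^- Kc U s <= Pu R U s.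
Proof.
move=> /KcP[[p Up <-] _]; have := @Pu_ge [:: p] s isT; rewrite big_seq1; apply.
by move=> q; rewrite inE => /eqP ->.
Qed.

Definition strings_below (n : nat) : seq bstring :=
  [seq bits j l | l <- index_iota 0 n, j <- index_iota 0 (2 ^ l)].

Lemma strings_below_uniq n : uniq (strings_below n).
Proof.
apply: allpairs_uniq_dep => [|l _|]; [exact: iota_uniq|exact: iota_uniq|].
move=> x y /allpairsPdep[l [j [_ jl ->]]] {x}.
move=> /allpairsPdep[l' [j' [_ jl' ->]]] /= bE {y}.
have ll : l = l' by rewrite -(size_bits j l) bE size_bits.
move: jl jl'; rewrite -ll !mem_index_iota /= => jl jl'; congr existT.
by have := congr1 bits_val bE; rewrite !bits_val_bits -ll !modn_small.
Qed.

Lemma mem_strings_below n (p : bstring) :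
  (size p < n)%N -> p \in strings_below n.
Proof.
move=> pn; apply/allpairsPdep; exists (size p), (bits_val p).
by rewrite !mem_index_iota bits_valK bits_val_lt pn.
Qed.

Variable eU : recf.
Hypothesis eU_computes : forall (s : bstring) (y : nat),
  eval eU [:: pickle s] y <-> exists t, U s = Some t /\ y = pickle t.

Definition found (n : nat) (s p : bstring) : bool :=
  step n eU [:: pickle p] == Some (pickle s).

(* [Pu_numer n s / 2 ^ n] sums up the programs of [s] of length less than [n]
   that are found at stage [n]. *)
Definition Pu_numer (n : nat) (s : bstring) : nat :=
  (\sum_(0 <= l < n) \sum_(0 <= j < 2 ^ l)
     found n s (bits j l) * 2 ^ (n - l))%N.

Definition Pu_stage (K : numFieldType) (n : nat) (s : bstring) : K :=
  (Pu_numer n s)%:R / (2 ^ n)%:R.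

Lemma Pu_stageE (K : numFieldType) n s :
  Pu_stage K n s = \sum_(p <- strings_below n | found n s p) 2 ^- size p.
Proof.
rewrite /Pu_stage /Pu_numer natr_sum mulr_suml [RHS]big_mkcond big_allpairs_dep.
apply: eq_big_nat => l /andP[_ /ltnW ln]; rewrite natr_sum mulr_suml.
apply: eq_bigr => j _; rewrite size_bits.
case: ifP => _; last by rewrite mul0n mul0r.
rewrite mul1n !natrX -[X in _ / _ ^+ X](subnK ln) exprD invfM mulrA.
by rewrite divff ?mul1r.
Qed.

Lemma found_program n s p : found n s p -> U p = Some s.
Proof.
by move=> /eqP /step_sound /eU_computes[t [-> /(pcan_inj pickleK) ->]].
Qed.

Lemma program_found s p : U p = Some s ->
  (\forall n \near \oo, (p \in strings_below n) && found n s p)%classic.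
Proof.
move=> Up; have /step_complete p_halts : eval eU [:: pickle p] (pickle s).
  by apply/eU_computes; exists s.
apply: filterS2 (nbhs_infty_gt (size p)) p_halts => n p_lt E.
by rewrite mem_strings_below //= /found E.
Qed.

Lemma Pu_stage_le n s : Pu_stage R n s <= Pu R U s.
Proof.
rewrite Pu_stageE -big_filter; apply: Pu_ge.
  exact/filter_uniq/strings_below_uniq.
by move=> p; rewrite mem_filter => /andP[/found_program].
Qed.

Lemma Pu_stage_cvg s : ((Pu_stage R n s) @[n --> \oo] --> Pu R U s)%classic.
Proof.
apply/cvgrPdist_lt => e e0; have [L [uL UL PL]] := Pu_approx s e0.
have : (\forall n \near \oo,
    {in L, forall p, (p \in strings_below n) && found n s p})%classic.
  elim: L UL {uL PL} => [|p L IH] UL; first exact: nearW.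
  have p_found := program_found (UL p (mem_head _ _)).
  have {}/IH L_found : {in L, forall p, U p = Some s}.
    by move=> q qL; apply: UL; rewrite inE qL orbT.
  apply: filterS2 p_found L_found => n pn Ln q.
  by rewrite inE => /predU1P[->|/Ln].
apply: filterS => n Ln; rewrite ger0_norm ?subr_ge0 ?Pu_stage_le //.
rewrite ltrBlDr -ltrBlDl; apply: lt_le_trans PL _.
rewrite Pu_stageE -[leRHS]big_filter; apply: ler_sum_subset => //.
- exact/filter_uniq/strings_below_uniq.
- by move=> p /Ln; rewrite mem_filter andbC.
Qed.

Lemma computable_Pu_stage :
  computable (enc_cons enc1) (fun y : nat * bstring => Pu_stage rat y.1 y.2).
Proof.
have c_found X (enc : encoding X) (G : X -> nat) (S P : X -> bstring) :
    computable enc G -> computable enc S -> computable enc P ->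
    computable enc (fun x => found (G x) (S x) (P x)).
  move=> cG cS cP; rewrite /found; apply: computable_eq; last by comp.
  apply: (computable_comp (h := fun x => (G x, P x))
    (computable_step eU enc1)) => /=.
  by comp.
apply: computable_ratio; last by comp.
by rewrite /Pu_numer; comp.
Qed.

End AlgorithmicProbability.

(** * Positive semi-definite matrices *)

Section PositiveSemidefinite.

Variables (R : realType) (N : nat).
Local Open Scope sesquilinear_scope.
Implicit Types A B : 'M[R[i]]_N.

Lemma form_rowE (P : 'M[R[i]]_N) A k :
  (row k P *m A *m (row k P) ^t*) 0 0 = (P *m A *m P ^t*) k k.
Proof.
transitivity ((row k (P *m A) *m P ^t*) 0 k); last by rewrite -row_mul mxE.
by rewrite row_mul [LHS]mxE [RHS]mxE; apply: eq_bigr => j _; rewrite !mxE.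
Qed.

Lemma psd_diag_ge0 A k : psd A -> 0 <= A k k.
Proof.
by move=> [_ /(_ (row k 1%:M))]; rewrite form_rowE mul1mx trmx1 map_mx1 mulmx1.
Qed.

Lemma psd_trace_ge0 A : psd A -> 0 <= \tr A.
Proof. by move=> pA; apply: sumr_ge0 => k _; exact: psd_diag_ge0. Qed.

Lemma psd_spectral A : psd A -> exists (P : 'M[R[i]]_N) (d : 'rV[R[i]]_N),
  [/\ P *m P ^t* = 1%:M, A = P ^t* *m diag_mx d *m P & forall k, 0 <= d 0 k].
Proof.
move=> [hA pA]; set P := spectralmx A; set d := spectral_diag A.
have uP : P \is unitarymx := spectral_unitarymx A.
have PP : P *m P ^t* = 1%:M by apply/unitarymxP.
have AE : A = P ^t* *m diag_mx d *m P.
  have /orthomx_spectralP : A \is normalmx by apply/normalmxP; rewrite hA.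
  by rewrite invmx_unitary.
exists P, d; split=> // k; have := pA (row k P); rewrite form_rowE.
suff -> : P *m A *m P ^t* = diag_mx d by rewrite mxE eqxx mulr1n.
by rewrite AE !mulmxA PP mul1mx -mulmxA PP mulmx1.
Qed.

Lemma trace_spectral (P : 'M[R[i]]_N) (d : 'rV[R[i]]_N) B :
  \tr (P ^t* *m diag_mx d *m P *m B) =
  \sum_k d 0 k * (row k P *m B *m (row k P) ^t*) 0 0.
Proof.
rewrite -!mulmxA mxtrace_mulC -!mulmxA; apply: eq_bigr => k _.
by rewrite mul_diag_mx mxE form_rowE !mulmxA.
Qed.

Lemma trace_psd_ge0 A B : psd A -> psd B -> 0 <= \tr (A *m B).
Proof.
move=> /psd_spectral[P [d [_ -> d0]]] [_ pB]; rewrite trace_spectral.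
by apply: sumr_ge0 => k _; rewrite mulr_ge0.
Qed.

Lemma trace_psd_le A B : psd A -> psd B -> \tr (A *m B) <= \tr A * \tr B.
Proof.
move=> pA pB; have trB0 := psd_trace_ge0 pB; have [_ formB] := pB.
have [P [d [PP AE d0]]] := psd_spectral pA; have PP' := mulmx1C PP.
have trA : \tr A = \sum_k d 0 k.
  by rewrite AE -mulmxA mxtrace_mulC -mulmxA PP mulmx1 mxtrace_diag.
have trB : \tr B = \sum_k (row k P *m B *m (row k P) ^t*) 0 0.
  rewrite -[B in LHS]mulmx1 -PP' mulmxA mxtrace_mulC mulmxA.
  by apply: eq_bigr => k _; rewrite form_rowE.
rewrite {1}AE trace_spectral trB mulr_sumr; apply: ler_sum => k _.
by rewrite ler_wpM2r // trA (bigD1 k) //= lerDl sumr_ge0.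
Qed.

Lemma loewner0 A : loewner 0 A <-> psd A.
Proof. by rewrite /loewner subr0. Qed.

Lemma trace_loewner A B C :
  psd A -> loewner B C -> \tr (A *m B) <= \tr (A *m C).
Proof.
by move=> pA /(trace_psd_ge0 pA); rewrite mulmxBr raddfB /= subr_ge0.
Qed.

Lemma trace_psd_real A B : psd A -> psd B ->
  \tr (A *m B) = ((complex.Re (\tr (A *m B)))%:C)%C.
Proof. by move=> pA pB; rewrite RRe_real // ger0_real // trace_psd_ge0. Qed.

Lemma hermitian_scalar (x : R) : Defs.hermitian ((x%:C)%C%:M : 'M[R[i]]_N).
Proof.
rewrite /Defs.hermitian tr_scalar_mx map_scalar_mx /=; congr (_%:M).
by apply: conj_Creal; rewrite realE -[0]/((0 : R)%:C)%C !lecR -realE num_real.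
Qed.

Lemma loewner_scalar (x y : R) : x <= y ->
  loewner ((x%:C)%C%:M : 'M[R[i]]_N) ((y%:C)%C%:M).
Proof.
move=> xy; rewrite /loewner -raddfB -rmorphB; split=> [|v].
  exact: hermitian_scalar.
rewrite mul_mx_scalar -scalemxAl mxE; apply: mulr_ge0.
  by rewrite -[0]/((0 : R)%:C)%C lecR subr_ge0.
by rewrite mxE sumr_ge0 // => k _; rewrite !mxE mul_conjC_ge0.
Qed.

End PositiveSemidefinite.

(** * Lower-computable semi-POVMs *)

Section LowerComputable.

Variables (R : realType) (N : nat).

Lemma toC_scalar (q : rat) :
  toC R ((q%:M, 0) : gaussQ N) = ((ratr q)%:C)%C%:M.
Proof.
apply/matrixP => j k; rewrite !mxE /= rmorph0.
by case: (j == k); rewrite ?mulr1n ?mulr0n ?rmorph0.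
Qed.

Lemma semimeasure_scalar_semiPOVM (m : bstring -> R) : semimeasure m ->
  semiPOVM (fun s => ((m s)%:C)%C%:M : 'M[R[i]]_N).
Proof.
move=> [m0 m1]; split=> [s|S uS].
  by have := loewner_scalar N (m0 s); rewrite -[X in loewner X]scalemx1 scale0r.
have -> : \sum_(s <- S) ((m s)%:C)%C%:M =
    ((\sum_(s <- S) m s)%:C)%C%:M :> 'M[R[i]]_N.
  by rewrite rmorph_sum raddf_sum.
rewrite -[1%:M](_ : ((1 : R)%:C)%C%:M = _) //; exact/loewner_scalar/m1.
Qed.

Lemma scalar_lower_computable (m : bstring -> R) (a : nat -> bstring -> rat) :
  semimeasure m -> computable (enc_cons enc1) (fun y => a y.1 y.2) ->
  (forall s, ((ratr (a n s) : R) @[n --> \oo] --> m s)%classic) ->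
  (forall n s, ratr (a n s) <= m s) ->
  lower_computable (fun s => ((m s)%:C)%C%:M : 'M[R[i]]_N).
Proof.
move=> m_semi c_a a_cvg a_le; split; first exact: semimeasure_scalar_semiPOVM.
exists (fun n s => ((a n s)%:M, 0)); split; last split; last split.
- have [e eP] : computable (enc_cons enc1)
      (fun y => ((a y.1 y.2)%:M, 0) : 'M[rat]_N * 'M[rat]_N).
    apply: computable_pair; last by comp.
    apply: computable_mx => j k; have [->|jk] := eqVneq j k.
      by apply: computable_ext c_a => y; rewrite mxE eqxx mulr1n.
    apply: computable_ext (computable_const _ 0) => y.
    by rewrite mxE (negbTE jk).
  by exists e => n s; exact: (eP (n, s)).
- by move=> n s; rewrite toC_scalar; exact: hermitian_scalar.
- move=> s j k; rewrite mxE; split; under eq_fun do rewrite toC_scalar mxE.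
    by case: (j == k); [exact: a_cvg|exact: cvg_cst].
  by case: (j == k); exact: cvg_cst.
- by move=> n s; rewrite toC_scalar; exact: loewner_scalar.
Qed.

Lemma Pu_lower_computable (U : bstring -> option bstring) : computer U ->
  lower_computable (fun s => ((Pu R U s)%:C)%C%:M : 'M[R[i]]_N).
Proof.
move=> [[e eU] pf].
have stageE n s : ratr (Pu_stage e rat n s) = Pu_stage e R n s :> R.
  by rewrite /Pu_stage fmorph_div /= !ratr_nat.
apply: scalar_lower_computable (semimeasure_Pu R pf)
  (computable_Pu_stage e) _ _ => [s|n s].
  by under eq_fun do rewrite stageE; exact: Pu_stage_cvg.
by rewrite stageE; exact: Pu_stage_le.
Qed.

Lemma loewner_Re_diag (A B : 'M[R[i]]_N) k :
  loewner A B -> complex.Re (A k k) <= complex.Re (B k k).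
Proof.
by move=> /(psd_diag_ge0 k); rewrite !mxE subr_ge0 lecE => /andP[_].
Qed.

Lemma semiPOVM_diag_semimeasure (M : bstring -> 'M[R[i]]_N) k :
  semiPOVM M -> semimeasure (fun s => complex.Re (M s k k)).
Proof.
move=> [M0 M1]; split=> [s|S /M1 /(loewner_Re_diag k)].
  by have := loewner_Re_diag k (M0 s); rewrite mxE.
by rewrite mxE eqxx summxE raddf_sum.
Qed.

Lemma lower_computable_diag (M : bstring -> 'M[R[i]]_N) k :
  lower_computable M -> lower_semicomputable (fun s => complex.Re (M s k k)).
Proof.
move=> [_ [f [[e eP] [_ [f_cvg f_le]]]]].
have cf : computable (enc_cons enc1)
    (fun y => f y.1 y.2 : 'M[rat]_N * 'M[rat]_N).
  by exists e => -[n s]; exact: eP.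
have fE n s : complex.Re (toC R (f n s) k k) = ratr ((f n s).1 k k).
  by rewrite mxE.
exists (fun n l s => 2 ^- l < (f n s).1 k k).
  apply: computable_pow2V_lt; first by comp.
  apply: computable_mx_entry; apply: computable_fst.
  by apply: (computable_comp (h := fun y => (y.1, y.2.2)) cf) => /=; comp.
have testE l n s :
    2 ^- l < (f n s).1 k k = (2 ^- l < (ratr ((f n s).1 k k) : R)).
  by rewrite -(ltr_rat R) fmorphV rmorphXn /= ratr_nat.
move=> l s; split=> [l_lt|[n]]; last first.
  by rewrite testE -fE => /lt_le_trans; apply; exact: loewner_Re_diag.
have [diag_cvg _] := f_cvg s k k.
have [n /= n_gt] := filter_ex (cvgr_gt _ diag_cvg _ l_lt).
by exists n; rewrite testE -fE.
Qed.

End LowerComputable.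

Lemma universal_trace_ge_Pu (R : realType) N (U : bstring -> option bstring)
    (M : bstring -> 'M[R[i]]_N) : computer U -> universal M ->
  exists2 a : R, 0 < a & forall (rho : 'M[R[i]]_N) s, density rho ->
    a * Pu R U s <= complex.Re (\tr (rho *m M s)).
Proof.
move=> compU [_ M_univ].
have [a [a0 aM]] := M_univ _ (Pu_lower_computable R N compU).
exists a => // rho s [_ [rho_psd tr_rho]].
have := trace_loewner rho_psd (aM s).
rewrite -scalemxAr mxtraceZ mul_mx_scalar mxtraceZ tr_rho mulr1 -rmorphM lecE.
by move=> /andP[_].
Qed.

Lemma trace_density_le_Kc (R : realType) N (U : bstring -> option bstring)
    (M : bstring -> 'M[R[i]]_N) : optimal U -> lower_computable M ->
  exists2 b : R, 0 < b & forall (rho : 'M[R[i]]_N) s, density rho ->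
    complex.Re (\tr (rho *m M s)) <= b * 2 ^- Kc U s.
Proof.
move=> optU lM; have [M_semi _] := lM.
have /choice[c diag_le] : forall k, exists c : nat, forall s,
    complex.Re (M s k k) <= 2 ^+ c * 2 ^- Kc U s.
  move=> k; apply: coding_theorem optU _ (lower_computable_diag k lM).
  exact: semiPOVM_diag_semimeasure.
exists (1 + \sum_k 2 ^+ c k).
  by rewrite ltr_pwDl // sumr_ge0 // => k _; rewrite exprn_ge0.
move=> rho s [_ [rho_psd tr_rho]]; have /loewner0 M_psd := M_semi.1 s.
have := trace_psd_le rho_psd M_psd.
rewrite tr_rho mul1r lecE => /andP[_] /le_trans; apply.
rewrite mulrDl mul1r raddf_sum mulr_suml -[leLHS]add0r lerD ?pow2V_ge0 //.
by apply: ler_sum => k _; exact: diag_le.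
Qed.

Lemma log2_pow2V_bound (R : realType) (x a b : R) (k : nat) : 0 < a -> 0 < b ->
  a * 2 ^- k <= x <= b * 2 ^- k ->
  `| k%:R + log2 x | <= `|log2 a| + `|log2 b|.
Proof.
move=> a0 b0 /andP[ax xb].
have ln2_gt0 : 0 < ln (2 : R) by rewrite ln_gt0 // ltr1n.
have x0 : 0 < x by apply: lt_le_trans ax; rewrite mulr_gt0 ?pow2V_gt0.
have log2_shift (y : R) : 0 < y -> log2 (y * 2 ^- k) = log2 y - k%:R.
  move=> y0; rewrite /log2 lnM ?posrE ?pow2V_gt0 //.
  rewrite lnV ?posrE ?exprn_gt0 // lnXn //.
  by rewrite mulrBl -[ln 2 *+ k]mulr_natl mulfK // gt_eqF.
have log2_le (y z : R) : 0 < y -> y <= z -> log2 y <= log2 z.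
  move=> y0 yz; rewrite /log2 ler_pM2r ?invr_gt0 // ler_ln ?posrE //.
  exact: lt_le_trans yz.
have := log2_le _ _ (mulr_gt0 a0 (pow2V_gt0 R k)) ax; have := log2_le _ _ x0 xb.
rewrite !log2_shift //.
have := ler_norm (- log2 a); have := ler_norm (log2 b); rewrite normrN.
have := normr_ge0 (log2 a); have := normr_ge0 (log2 b).
by rewrite ler_norml => *; apply/andP; split; lra.
Qed.

Theorem mainTheorem9 (R : realType) (N : nat) (hN : (0 < N)%N)
    (U : bstring -> option bstring) (hU : optimal U)
    (M : bstring -> 'M[R[i]]_N) (hM : universal M) :
  exists (c c' : R), 0 <= c /\ 0 < c' /\
    forall (rho : 'M[R[i]]_N) (s : bstring), density rho ->
      `| (Kc U s)%:R + log2 (complex.Re (\tr (rho *m M s))) | <= c /\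
      ((c'%:C)%C * ((Pu R U s)%:C)%C <= \tr (rho *m M s) :> R[i]) /\
      ((c'%:C)%C * \tr (rho *m M s) <= ((Pu R U s)%:C)%C :> R[i]).
Proof.
have [compU _] := hU; have [lM _] := hM; have [M_semi _] := lM.
have [a a0 P_le] := universal_trace_ge_Pu compU hM.
have [b b0 le_K] := trace_density_le_Kc hU lM.
exists (`|log2 a| + `|log2 b|), (Num.min a b^-1); split; first exact: addr_ge0.
split=> [|rho s rho_density]; first by rewrite lt_min a0 invr_gt0.
have [_ [rho_psd _]] := rho_density; have /loewner0 M_psd := M_semi.1 s.
have K_le_P := pow2V_Kc_le_Pu R compU.2 (optimal_surjective s hU).
have P_ge0 := Pu_ge0 R compU.2 s.
have {}P_le := P_le _ s rho_density; have {}le_K := le_K _ s rho_density.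
rewrite (trace_psd_real rho_psd M_psd) /=.
set x := complex.Re (\tr (rho *m M s)) in P_le le_K *.
have x_ge0 : 0 <= x by apply: le_trans P_le; rewrite mulr_ge0 // ltW.
rewrite -!rmorphM !lecR; split; [|split].
- apply: log2_pow2V_bound => //.
  by rewrite le_K andbT (le_trans _ P_le) // ler_pM2l.
- by apply: le_trans P_le; rewrite ler_wpM2r // ge_min lexx.
- rewrite (le_trans _ K_le_P) // (@le_trans _ _ (b^-1 * x)) ?ler_pdivrMl //.
  by rewrite ler_wpM2r // ge_min lexx orbT.
Qed.
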